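(* Let $\mathbf{k}$ be a field of characteristic zero, $V$ a finite-dimensional $\mathbf{k}$-vector space with basis $e_1,\dots,e_n$, and $R\in\operatorname{End}(V\otimes V)$ a unitary solution of the quantum Yang–Baxter equation. Let $SR_m\subset\operatorname{End}(V^{\otimes m})$ be the image of the $R$-symmetric action of $S_m$ (the subalgebra generated by the elements $\tau_{(b,b+1)}R^{b,b+1}$), and let $HR_m\subset\operatorname{End}(V^{\otimes m})$ be the span of the maps $(\mathrm{id}\otimes\phi)\circ\Delta$, where $\Delta:V^{\otimes m}\to V^{\otimes m}\otimes H_R$ is the comodule action and $\phi:H_R\to\mathbf{k}$ is any linear map. Then $$\operatorname{End}_{SR_m}(V^{\otimes m})=HR_m,\qquad \operatorname{End}_{HR_m}(V^{\otimes m})=SR_m,\qquad V^{\otimes m}\cong\bigoplus_{\lambda}\rho_{\lambda,S_m}\otimes\rho_{\lambda,H_R},$$ where $\lambda$ runs over Young diagrams (partitions of $m$) parametrizing the irreducible representations $\rho_{\lambda,S_m}$ of $S_m$, and $\rho_{\lambda,H_R}:=c_\lambda(R)V^{\otimes m}$ is an $H_R$-subcomodule of $V^{\otimes m}$, with $c_\lambda\in\mathbf{k}[S_m]$ the Young symmetrizer of $\lambda$ and $c_\lambda(R)\in\operatorname{End}(V^{\otimes m})$ its image under the $R$-permutation action. Furthermore, $\rho_{\lambda,H_R}$ is an irreducible $H_R$-comodule, and this is the multiplicity-free decomposition of $V^{\otimes m}$ into irreducible $SR_m\otimes HR_m$-modules.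
   Context: $R^{ij}$ denotes $R$ acting on tensor factors $i,j$; $\tau_\sigma$ denotes the standard action of $\sigma\in S_m$ on $V^{\otimes m}$ by permuting factors. Unitary: $R^{21}R=\mathrm{Id}$, where $R^{21}=\tau_{(12)}R\tau_{(12)}$. QYBE: $R^{12}R^{13}R^{23}=R^{23}R^{13}R^{12}$. The $R$-permutation action of $S_m$ on $V^{\otimes m}$ is given on simple transpositions by $(b,b+1)*_R v:=\tau_{(b,b+1)}R^{b,b+1}v$. $H_R$ (Faddeev–Reshetikhin–Takhtajan bialgebra): let $F=\mathbf{k}\langle L_{ij}\rangle_{1\le i,j\le n}$ be the free algebra, $L=\sum_{i,j}e_{ij}\otimes L_{ij}\in\operatorname{End}(V)\otimes F$ ($e_{ij}$ matrix units), $L^{13}=\sum e_{ij}\otimes1\otimes L_{ij}$, $L^{23}=\sum 1\otimes e_{ij}\otimes L_{ij}$, $R^{12}=R\otimes1$; then $H_R=F/I_R$ where $I_R$ is the ideal generated by the entries of $R^{12}L^{13}L^{23}-L^{23}L^{13}R^{12}\in\operatorname{End}(V)\otimes\operatorname{End}(V)\otimes F$, with coproduct $\Delta(L_{ij})=\sum_k L_{ik}\otimes L_{kj}$ and counit $\epsilon(L_{ij})=\delta_{ij}$. $V$ is an $H_R$-comodule via $e_j\mapsto\sum_i e_i\otimes L_{ij}$, and $V^{\otimes m}$ is its tensor power comodule: $e_{j_1}\otimes\cdots\otimes e_{j_m}\mapsto\sum_{i_1,\dots,i_m}e_{i_1}\otimes\cdots\otimes e_{i_m}\otimes L_{i_1j_1}\cdots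 L_{i_mj_m}$.
   Formalization: Irreducibility of ρ_{λ,H_R}, and irreducibility and pairwise non-isomorphism of the summands, are stated only for nonzero ones: ρ_{λ,H_R} can vanish (R = Id, n = 1, λ = (1,1)), and a zero comodule is not irreducible. *)

(* Defs.v *)
From HB Require Import structures.
From mathcomp Require Import all_boot all_order all_algebra all_fingroup.
Set Implicit Arguments. Unset Strict Implicit. Unset Printing Implicit Defensive.
Import GRing.Theory.
Local Open Scope ring_scope.

(*  V = F^n with basis e_0..e_{n-1}; V^{(x)m} has basis e_I indexed by       *)
(*  multi-indices I : {ffun 'I_m -> 'I_n} (e_I = e_{I 0} (x) ... (x) e_{I(m-1)}).*)
(*  An endomorphism of V^{(x)m} is a matrix A : 'M_#|tens n m| in ROW         *)
(*  convention: A (enum_rank J) (enum_rank I) = coefficient of e_I in A(e_J), *)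
(*  so A acts on coordinate row vectors by v |-> v *m A, the image of A is    *)
(*  its row space, and composition "A after B" is  compo A B = B *m A.        *)
(*  R : End(V (x) V) is given by its entries:                                 *)
(*     R(e_j1 (x) e_j2) = sum_{i1,i2} R i1 i2 j1 j2  e_i1 (x) e_i2.           *)

Definition tens (n m : nat) := {ffun 'I_m -> 'I_n}.

Definition compo (F : fieldType) k (A B : 'M[F]_k) : 'M[F]_k := B *m A.

Definition mxT (F : fieldType) (T T' : finType) (f : T -> T' -> F)
  : 'M[F]_(#|T|, #|T'|) := \matrix_(i, j) f (enum_val i) (enum_val j).

Section RSchurWeyl.
Variable F : fieldType.
Variable n : nat.
Variable R : 'I_n -> 'I_n -> 'I_n -> 'I_n -> F.

Definition op (m : nat) := 'M[F]_#|tens n m|.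

Definition Rop m (a b : 'I_m) : op m :=
  mxT (fun J I : tens n m => R (I a) (I b) (J a) (J b) *
        ([forall k : 'I_m, (k != a) && (k != b) ==> (I k == J k)])%:R).

Definition R_unitary : Prop :=
  compo (Rop (inord 1 : 'I_2) (inord 0)) (Rop (inord 0 : 'I_2) (inord 1)) = 1%:M.

Definition qybe : Prop :=
  compo (compo (Rop (inord 0 : 'I_3) (inord 1)) (Rop (inord 0 : 'I_3) (inord 2)))
        (Rop (inord 1 : 'I_3) (inord 2)) =
  compo (compo (Rop (inord 1 : 'I_3) (inord 2)) (Rop (inord 0 : 'I_3) (inord 2)))
        (Rop (inord 0 : 'I_3) (inord 1)).

Definition tau_op m (s : {perm 'I_m}) : op m :=
  mxT (fun J I : tens n m => (I == [ffun k => J (s k)])%:R).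

End RSchurWeyl.

Lemma adj_lt1 m (b : 'I_m.-1) : (b < m)%N.
Proof. by case: m b => [|m] [b hb] //=; apply: ltnW. Qed.
Lemma adj_lt2 m (b : 'I_m.-1) : (b.+1 < m)%N.
Proof. by case: m b => [|m] [b hb]. Qed.

Definition pos1 m (b : 'I_m.-1) : 'I_m := Ordinal (adj_lt1 b).
Definition pos2 m (b : 'I_m.-1) : 'I_m := Ordinal (adj_lt2 b).

Definition adj m (b : 'I_m.-1) : {perm 'I_m} := tperm (pos1 b) (pos2 b).

Section RAction.
Variable F : fieldType.
Variable n : nat.
Variable R : 'I_n -> 'I_n -> 'I_n -> 'I_n -> F.

Definition gen_op m (b : 'I_m.-1) : op F n m :=
  compo (tau_op F n (adj b)) (Rop R (pos1 b) (pos2 b)).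

Definition letter_op m (o : option 'I_m.-1) : op F n m :=
  if o is Some b then gen_op b else 1%:M.
Definition letter_perm m (o : option 'I_m.-1) : {perm 'I_m} :=
  if o is Some b then adj b else 1%g.

(* word [o1; ...; ok]  |->  s_{o1} o ... o s_{ok}  (operators and permutations) *)
Definition word_op m (w : seq (option 'I_m.-1)) : op F n m :=
  foldl (fun A o => compo A (letter_op o)) 1%:M w.
Definition word_perm m (w : seq (option 'I_m.-1)) : {perm 'I_m} :=
  foldl (fun p o => (letter_perm o * p)%g) 1%g w.

(* The R-permutation action of sigma in S_m : evaluate the generators along a
   word (of length <= m*m, None = empty letter) representing sigma. *)
Definition Ract m (s : {perm 'I_m}) : op F n m :=
  if [pick w : (m * m).-tuple (option 'I_m.-1) | word_perm w == s] is Some w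
  then word_op w else 1%:M.

Definition SR m (A : op F n m) : Prop :=
  exists (ws : seq (seq 'I_m.-1)) (cs : seq F),
    A = \sum_(i < size ws) cs`_i *: word_op (map Some (nth [::] ws i)).

(* The FRT bialgebra H_R = F<L_ij>/I_R.  Words in the generators L_ij are
   seq ('I_n * 'I_n); a linear map phi : H_R -> F is the same as a function
   f on words (its values on the word basis of the free algebra) vanishing
   on the ideal I_R, i.e. on every u * r * v with r an entry of
   R^{12}L^{13}L^{23} - L^{23}L^{13}R^{12}, whose ((i1,i2),(j1,j2)) entry is
   sum_{k1,k2} R i1 i2 k1 k2 L_{k1 j1} L_{k2 j2}
     - sum_{k1,k2} L_{i2 k2} L_{i1 k1} R k1 k2 j1 j2. *)
Definition Lgen := ('I_n * 'I_n)%type.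

Definition vanishes_on_IR (f : seq Lgen -> F) : Prop :=
  forall (u v : seq Lgen) (i1 i2 j1 j2 : 'I_n),
    \sum_(k1 < n) \sum_(k2 < n) R i1 i2 k1 k2 * f (u ++ [:: (k1, j1); (k2, j2)] ++ v)
  = \sum_(k1 < n) \sum_(k2 < n) f (u ++ [:: (i2, k2); (i1, k1)] ++ v) * R k1 k2 j1 j2.

Definition monoIJ m (I J : tens n m) : seq Lgen := [seq (I k, J k) | k <- enum 'I_m].

(* HR_m : the maps (id (x) phi) o Delta, Delta(e_J) = sum_I e_I (x) L_{I,J};
   (these already form a linear subspace, so this set is their span) *)
Definition HR m (A : op F n m) : Prop :=
  exists f : seq Lgen -> F, vanishes_on_IR f /\
    A = mxT (fun J I : tens n m => f (monoIJ I J)).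

End RAction.

(* partitions of m : nonincreasing m-tuples of parts (padded with zeros) *)
Definition is_partn m (t : m.-tuple 'I_m.+1) : bool :=
  sorted geq [seq val x | x <- t] && ((\sum_(x <- t) val x)%N == m).
Definition ypart m := {t : m.-tuple 'I_m.+1 | is_partn t}.

Section Young.
Variable m : nat.
Variable lam : ypart m.

Definition part_len (i : 'I_m) : nat := val (tnth (val lam) i).
Definition cum (i : 'I_m) : nat := (\sum_(j < m | (j < i)%N) part_len j)%N.
(* canonical tableau: the boxes of row i carry cum i, ..., cum i + lam_i - 1 *)
Definition in_row (i : 'I_m) (k : 'I_m) : bool := (cum i <= k < cum i + part_len i)%N.
Definition same_row (k k' : 'I_m) : bool := [exists i, in_row i k && in_row i k'].
Definition same_col (k k' : 'I_m) : bool :=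
  [exists i, exists i', [&& in_row i k, in_row i' k' & (k - cum i == k' - cum i')%N]].

Definition Pgrp : {set {perm 'I_m}} := [set s : {perm 'I_m} | [forall k, same_row k (s k)]].
Definition Qgrp : {set {perm 'I_m}} := [set s : {perm 'I_m} | [forall k, same_col k (s k)]].

(* Young symmetrizer c_lam = a_lam b_lam = sum_{p in P, q in Q} sgn(q) p o q,
   as a function 'S_m -> F (coefficients in the group algebra); note that the
   composite p o q is (q * p)%g in mathcomp. *)
Definition cl (F : fieldType) (s : {perm 'I_m}) : F :=
  \sum_(p in Pgrp) \sum_(q in Qgrp) ((q * p)%g == s)%:R * (-1) ^+ odd_perm q.
End Young.

Notation Bidx n m := (ypart m * ({perm 'I_m} * tens n m))%type.

Section Decomp.
Variable F : fieldType.
Variable n m : nat.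
Variable R : 'I_n -> 'I_n -> 'I_n -> 'I_n -> F.

Definition cR (lam : ypart m) : op F n m := \sum_(s : {perm 'I_m}) cl lam F s *: Ract R s.

(* rho_{lam,H_R} = c_lam(R) V^{(x)m} : the row space (= image) of c_lam(R) *)
Definition rhoH (lam : ypart m) : 'M[F]_#|tens n m| := cR lam.

(* rho_{lam,S_m} = F[S_m] c_lam (left ideal), as the row space of the matrix
   whose row s is  e_s c_lam ; S_m acts by left multiplication. *)
Definition rhoS (lam : ypart m) : 'M[F]_#|{perm 'I_m}| :=
  mxT (fun r x : {perm 'I_m} => cl lam F (x * r^-1)%g).

(* tensor product of subspaces U1 of F[S_m] and U2 of V^{(x)m}, inside
   F[S_m] (x) V^{(x)m} with basis indexed by {perm 'I_m} * tens n m *)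
Definition tsp k1 k2 (U1 : 'M[F]_(k1, #|{perm 'I_m}|)) (U2 : 'M[F]_(k2, #|tens n m|))
  : 'M[F]_(#|{: 'I_k1 * 'I_k2}|, #|{: {perm 'I_m} * tens n m}|) :=
  mxT (fun (r : 'I_k1 * 'I_k2) (c : {perm 'I_m} * tens n m) =>
         U1 r.1 (enum_rank c.1) * U2 r.2 (enum_rank c.2)).

Definition emb (lam : ypart m) : 'M[F]_(#|{: {perm 'I_m} * tens n m}|, #|{: Bidx n m}|) :=
  mxT (fun c (d : Bidx n m) => (d == (lam, c))%:R).

Definition summand (lam : ypart m) := tsp (rhoS lam) (rhoH lam) *m emb lam.

Definition Dsp : 'M[F]_#|{: Bidx n m}| := (\sum_(lam : ypart m) <<summand lam>>)%MS.

(* sigma acts by left multiplication on the F[S_m] factor: e_r |-> e_{sigma o r} *)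
Definition actS (s : {perm 'I_m}) : 'M[F]_#|{: Bidx n m}| :=
  mxT (fun d d' : Bidx n m => (d' == (d.1, ((d.2.1 * s)%g, d.2.2)))%:R).

Definition actH (h : op F n m) : 'M[F]_#|{: Bidx n m}| :=
  mxT (fun d d' : Bidx n m => ((d.1 == d'.1) && (d.2.1 == d'.2.1))%:R *
                          h (enum_rank d.2.2) (enum_rank d'.2.2)).

End Decomp.

Definition stable_under (F : fieldType) k r (A : 'M[F]_k) (U : 'M[F]_(r, k)) : bool :=
  (U *m A <= U)%MS.

Definition irreducible_for (F : fieldType) k r (P : 'M[F]_k -> Prop) (U : 'M[F]_(r, k)) : Prop :=
  (0 < \rank U)%N /\
  forall W : 'M[F]_k, (W <= U)%MS -> (forall A, P A -> stable_under A W) ->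
    \rank W = 0%N \/ (W == U)%MS.

Definition SW_decomposition (F : fieldType) n m (R : 'I_n -> 'I_n -> 'I_n -> 'I_n -> F)
   (Phi : 'M[F]_(#|{: Bidx n m}|, #|tens n m|)) : Prop :=
  let D := Dsp m R in
  let W := fun lam => summand R lam *m Phi in
  let SH := fun A : op F n m => SR R A \/ HR R A in
  [/\ \rank (D *m Phi) = \rank D /\ row_full (D *m Phi),
      forall (s : {perm 'I_m}) (x : 'rV[F]_#|{: Bidx n m}|),
        (x <= D)%MS -> x *m actS F n s *m Phi = x *m Phi *m Ract R s,
      forall (h : op F n m) (x : 'rV[F]_#|{: Bidx n m}|), HR R h ->
        (x <= D)%MS -> x *m actH h *m Phi = x *m Phi *m h,
      forall lam, (0 < \rank (W lam))%N -> irreducible_for SH (W lam) &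
      forall lam mu, lam != mu -> (0 < \rank (W lam))%N -> (0 < \rank (W mu))%N ->
        ~ exists T : op F n m,
            [/\ \rank (W lam *m T) = \rank (W lam), (W lam *m T == W mu)%MS &
                forall (x : 'rV[F]_#|tens n m|) (A : op F n m),
                  (x <= W lam)%MS -> SH A -> x *m A *m T = x *m T *m A]].

(* Main.v *)
Require Import Defs.
From HB Require Import structures.
From mathcomp Require Import all_boot all_order all_algebra all_fingroup.
From mathcomp Require Import zify.
Import GRing.Theory.
Set Implicit Arguments. Unset Strict Implicit. Unset Printing Implicit Defensive.
Local Open Scope ring_scope.

(** Unitarity and the Yang-Baxter equation make b |-> tau_(b,b+1) R^{b,b+1} satisfy the
    Coxeter relations, so they define a representation rho of S_m: any word in
    s_0, ..., s_{k-1} straightens to a word in s_0, ..., s_{k-2} followed by a descending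
    run, and a word for the identity permutation must have an empty run.  Read entrywise,
    the defining relations of H_R say exactly that HR_m is the commutant of rho.

    Write c for a Young symmetrizer.  Then c g c = k c(g^-1) c with k <> 0, symmetrizers of
    different shapes annihilate each other, and 1 = sum_lam a_lam sum_g g^-1 c_lam g.  Let
    E(X) = sum_g g^-1 X g, which lies in HR_m.  If u c = k u and v c = k v, then
    u E(phi v) = k (u phi) v for every covector phi.  Hence V^m c_lam is irreducible
    under HR_m.  If B commutes with HR_m, the same identity yields one element y of the group
    algebra with v B = v y for all v in V^m c_lam; with the resolution of 1 this
    puts B in SR_m.  The isomorphism of the decomposition is the evaluation
    (c g) (x) (w c) |-> w c c g. *)

(** * The group algebra *)

(** The resolution of 1 comes from a count: the conjugation averages of the symmetrizers are
    linearly independent class functions, one for each partition, while cycle type determines a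
    permutation up to conjugacy. So they span the class functions, among them the unit. Independence
    rests on k <> 0, which is a trace computation: c c = 0 would give right multiplication by c on
    the group algebra trace 0, whereas each of its diagonal entries is c(1) = 1. The scalar k
    c(g^-1) in c g c is read off with the trace form x |-> x(1). The obstacle in the action is that
    [Ract] selects some word for each permutation, so nothing multiplicative is known until any two
    words of one permutation are shown to give the same operator. Averages of rank one operators phi
    v supply enough explicit elements of HR_m to prove irreducibility and the bicommutant property
    directly, without a general double centralizer theorem. *)

Definition galg (F : fieldType) (gT : finGroupType) := {ffun gT -> F}.

Section GroupAlgebra.
Variables (F : fieldType) (gT : finGroupType).
Implicit Types (x y z : galg F gT) (g h s : gT) (a : F).

HB.instance Definition _ := GRing.Zmodule.on (galg F gT).

Definition galg_scale a x : galg F gT := [ffun s => a * x s].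

Fact galg_scaleA a b x : galg_scale a (galg_scale b x) = galg_scale (a * b) x.
Proof. by apply/ffunP=> s; rewrite !ffunE mulrA. Qed.
Fact galg_scale1 : left_id 1 galg_scale.
Proof. by move=> x; apply/ffunP=> s; rewrite ffunE mul1r. Qed.
Fact galg_scaleDr : right_distributive galg_scale +%R.
Proof. by move=> a x y; apply/ffunP=> s; rewrite !ffunE mulrDr. Qed.
Fact galg_scaleDl x : {morph galg_scale^~ x : a b / a + b}.
Proof. by move=> a b; apply/ffunP=> s; rewrite !ffunE mulrDl. Qed.

HB.instance Definition _ := GRing.Zmodule_isLmodule.Build F (galg F gT)
  galg_scaleA galg_scale1 galg_scaleDr galg_scaleDl.

Definition delta g : galg F gT := [ffun s => (s == g)%:R].
Definition conv x y : galg F gT := [ffun s => \sum_h x h * y (h^-1 * s)%g].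

Lemma convA : associative conv.
Proof.
move=> x y z; apply/ffunP=> s; rewrite !ffunE.
under [RHS]eq_bigr => h _ do rewrite ffunE mulr_suml.
rewrite exchange_big /=; apply: eq_bigr => g _; rewrite ffunE mulr_sumr.
rewrite (reindex_inj (mulgI g^-1%g)) /=; apply: eq_bigr => h _.
by rewrite mulrA invMg invgK -mulgA mulKVg.
Qed.

Lemma conv1l : left_id (delta 1) conv.
Proof.
move=> x; apply/ffunP=> s; rewrite !ffunE (bigD1 1%g) //= big1 ?addr0.
  by rewrite ffunE eqxx mul1r invg1 mul1g.
by move=> h /negPf hn; rewrite ffunE hn mul0r.
Qed.

Lemma conv1r : right_id (delta 1) conv.
Proof.
move=> x; apply/ffunP=> s; rewrite !ffunE (bigD1 s) //= big1 ?addr0.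
  by rewrite ffunE mulVg eqxx mulr1.
by move=> h hn; rewrite ffunE -eq_mulVg1 (negPf hn) mulr0.
Qed.

Lemma convDl : left_distributive conv +%R.
Proof.
by move=> x y z; apply/ffunP=> s; rewrite !ffunE -big_split /=; apply: eq_bigr => h _;
  rewrite ffunE mulrDl.
Qed.

Lemma convDr : right_distributive conv +%R.
Proof.
by move=> x y z; apply/ffunP=> s; rewrite !ffunE -big_split /=; apply: eq_bigr => h _;
  rewrite ffunE mulrDr.
Qed.

Lemma delta1_neq0 : delta 1 != 0.
Proof. by apply/eqP=> /ffunP/(_ 1%g)/eqP; rewrite !ffunE eqxx oner_eq0. Qed.

HB.instance Definition _ := GRing.Zmodule_isNzRing.Build (galg F gT)
  convA conv1l conv1r convDl convDr delta1_neq0.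

Lemma galgM x y s : (x * y) s = \sum_h x h * y (h^-1 * s)%g.
Proof. by rewrite ffunE. Qed.

Lemma galg_scaleE a x s : (a *: x) s = a * x s.
Proof. by rewrite ffunE. Qed.

Lemma galg_scaleAl a x y : a *: (x * y) = (a *: x) * y.
Proof.
apply/ffunP=> s; rewrite galg_scaleE !galgM mulr_sumr.
by apply: eq_bigr => h _; rewrite galg_scaleE mulrA.
Qed.

HB.instance Definition _ := GRing.Lmodule_isLalgebra.Build F (galg F gT) galg_scaleAl.

Lemma galg_scaleAr a x y : a *: (x * y) = x * (a *: y).
Proof.
apply/ffunP=> s; rewrite galg_scaleE !galgM mulr_sumr.
by apply: eq_bigr => h _; rewrite galg_scaleE mulrCA.
Qed.

HB.instance Definition _ := GRing.Lalgebra_isAlgebra.Build F (galg F gT) galg_scaleAr.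

Lemma galgDE x y s : (x + y) s = x s + y s.
Proof. by rewrite ffunE. Qed.

Lemma galg0E s : (0 : galg F gT) s = 0.
Proof. by rewrite ffunE. Qed.

Lemma galg_sumE I (r : seq I) (P : pred I) (f : I -> galg F gT) s :
  (\sum_(i <- r | P i) f i) s = \sum_(i <- r | P i) f i s.
Proof. by exact: (big_morph (fun x : galg F gT => x s) (fun x y => galgDE x y s) (galg0E s)). Qed.

Lemma galg_sum_delta x : x = \sum_s x s *: delta s.
Proof.
apply/ffunP=> s; rewrite galg_sumE (bigD1 s) //= big1 ?addr0.
  by rewrite galg_scaleE ffunE eqxx mulr1.
by move=> h hn; rewrite galg_scaleE ffunE eq_sym (negPf hn) mulr0.
Qed.

Lemma delta_mulE g x s : (delta g * x) s = x (g^-1 * s)%g.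
Proof.
rewrite galgM (bigD1 g) //= big1 ?addr0; first by rewrite ffunE eqxx mul1r.
by move=> h /negPf hn; rewrite ffunE hn mul0r.
Qed.

Lemma mul_deltaE g x s : (x * delta g) s = x (s * g^-1)%g.
Proof.
rewrite galgM (bigD1 (s * g^-1)%g) //= big1 ?addr0.
  by rewrite ffunE invMg invgK mulgKV eqxx mulr1.
move=> h hn; rewrite ffunE -(inj_eq (mulgI h)) mulKVg.
have /negPf -> : s != (h * g)%g by apply: contraNneq hn => ->; rewrite mulgK.
by rewrite mulr0.
Qed.

Lemma delta_mul g h : delta g * delta h = delta (g * h).
Proof.
by apply/ffunP=> s; rewrite delta_mulE !ffunE -(inj_eq (mulgI g)) mulKVg.
Qed.

Lemma delta1E : delta 1 = 1. Proof. by []. Qed.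

(** The coefficient at 1 is a trace form. Rotating a product cyclically under it is how scalars are
    computed for the symmetrizers. *)
Lemma galg_tr x y : (x * y) 1%g = (y * x) 1%g.
Proof.
rewrite !galgM [RHS](reindex_inj invg_inj) /=; apply: eq_bigr => h _.
by rewrite !mulg1 invgK mulrC.
Qed.

Lemma galg_coefE x g : x g = (x * delta g^-1) 1%g.
Proof. by rewrite mul_deltaE mul1g invgK. Qed.

Lemma galg_tr_eq0 x : (forall g, (x * delta g) 1%g = 0) -> x = 0.
Proof. by move=> h; apply/ffunP=> g; rewrite ffunE galg_coefE h. Qed.

Lemma card_neq0_char0 (charF : [pchar F] =i pred0) : #|gT|%:R != 0 :> F.
Proof.
by rewrite (pcharf0P F).1 // -lt0n; apply/card_gt0P; exists 1%g.
Qed.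

End GroupAlgebra.

(** * Tableaux *)

Section Tableaux.
Variable X : finType.
Implicit Types row col : X -> nat.

(** Recording a tableau by the coordinates of its entries lets a permutation of the entries act by
    precomposition. *)
Definition tableau row col :=
  (forall x y, row x = row y -> col x = col y -> x = y) /\
  (forall y i, (i < row y)%N -> exists2 y', row y' = i & col y' = col y).

(** For a tableau this is a partial sum of row lengths, the quantity compared in the dominance
    order. *)
Definition rows_below row i := #|[pred x | (row x < i)%N]|.

Lemma rows_below_split row col i N : (forall x, col x < N)%N ->
  rows_below row i = (\sum_(j < N) #|[pred x | (row x < i)%N & col x == j]|)%N.
Proof.
move=> ltN; rewrite /rows_below -sum1_card (partition_big (fun x => Ordinal (ltN x)) predT) //=.
by apply: eq_bigr => j _; rewrite -sum1_card; apply: eq_bigl => x; rewrite !inE.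
Qed.

(* A bad pair: two boxes in one row of the first tableau and one column of the second. *)
Section NoBadPair.
Variables row row' col' : X -> nat.
Hypothesis nobad : forall x y, row x = row y -> col' x = col' y -> x = y.
Hypothesis tab' : tableau row' col'.

(* Column j of the second tableau is top-justified, so it has exactly
   min(i, height) boxes in the first i rows; it meets each row of the first
   tableau at most once. *)
Lemma rows_below_col_le i j :
  (#|[pred x | (row x < i)%N & col' x == j]| <= #|[pred x | (row' x < i)%N & col' x == j]|)%N.
Proof.
have [/existsP[y /andP[/eqP cy iy]]|] := boolP [exists y, (col' y == j) && (i <= row' y)%N];
  last first.
  move=> h; apply: subset_leq_card; apply/subsetP=> x; rewrite !inE => /andP[_ cx].
  by rewrite cx andbT ltnNge; apply: contra h => hx; apply/existsP; exists x; rewrite cx.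
apply: (@leq_trans i).
  rewrite cardE -(size_map row) -[leqRHS](size_iota 0); apply: uniq_leq_size.
    rewrite map_inj_in_uniq ?enum_uniq // => x z; rewrite !mem_enum !inE.
    by move=> /andP[_ /eqP cx] /andP[_ /eqP cz] rxz; apply: nobad => //; rewrite cx cz.
  by move=> _ /mapP[x hx ->]; move: hx; rewrite mem_enum !inE mem_iota => /andP[].
rewrite cardE -(size_map row') -[leqLHS](size_iota 0); apply: uniq_leq_size;
  first exact: iota_uniq.
move=> k; rewrite mem_iota /= => ki.
have [z rz cz] := tab'.2 y k (leq_trans ki iy).
by apply/mapP; exists z; rewrite ?mem_enum ?inE ?rz ?cz ?cy ?eqxx ?ki.
Qed.

Let N := (\max_x col' x).+1.
Let ltN x : (col' x < N)%N.
Proof. by rewrite ltnS (leq_bigmax x). Qed.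

(** Summing the column bounds shows that the second shape dominates the first. *)
Lemma nobad_rows_below i : (rows_below row i <= rows_below row' i)%N.
Proof.
rewrite !(rows_below_split _ _ ltN); apply: leq_sum => j _; exact: rows_below_col_le.
Qed.

Hypothesis same_shape : forall i, rows_below row i = rows_below row' i.

(** Termwise inequalities between sums that agree are equalities. *)
Lemma rows_below_col_eq i j : (j < N)%N ->
  #|[pred x | (row x < i)%N & col' x == j]| = #|[pred x | (row' x < i)%N & col' x == j]|.
Proof.
move=> jN.
have h (k : 'I_N) : true -> (#|[pred x | (row x < i)%N & col' x == k]| <= #|[pred x | (row' x <
  i)%N & col' x == k]|
   ?= iff (#|[pred x | (row x < i)%N & col' x == k]| == #|[pred x | (row' x < i)%N & col' x ==
     k]|))%N.
  by split=> //; exact: rows_below_col_le.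
have [_] := leqif_sum h; rewrite -!rows_below_split // same_shape eqxx.
by move=> /esym/forallP/(_ (Ordinal jN))/eqP.
Qed.

Lemma row_succ (r : X -> nat) i j :
  #|[pred x | (r x < i.+1)%N & col' x == j]| =
  (#|[pred x | (r x < i)%N & col' x == j]| + #|[pred x | r x == i & col' x == j]|)%N.
Proof.
rewrite -cardUI [X in (_ + X)%N](_ : _ = 0%N) ?addn0.
  by apply: eq_card => x; rewrite !inE ltnS leq_eqVlt andb_orl orbC.
by apply: eq_card0 => x; rewrite !inE; case: (ltngtP (r x) i); rewrite ?andbF.
Qed.

(** Subtracting the counts for consecutive rows, row i of the first tableau and row i of the second
    meet each column of the second in equally many boxes. *)
Lemma nobad_cell x : exists y, (row' y == row x) && (col' y == col' x).
Proof.
have := rows_below_col_eq (row x).+1 (ltN x); rewrite !row_succ rows_below_col_eq // => /addnI e.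
have : (0 < #|[pred y | row' y == row x & col' y == col' x]|)%N.
  by rewrite -e; apply/card_gt0P; exists x; rewrite !inE !eqxx.
by case/card_gt0P => y; exists y.
Qed.

(** Sending each entry to the box found in [nobad_cell] is injective, again because there is no bad
    pair. *)
Lemma nobad_column_perm : exists q : {perm X},
  (forall x, col' (q x) = col' x) /\ (forall x, row' (q x) = row x).
Proof.
pose f x := xchoose (nobad_cell x).
have fP x : row' (f x) = row x /\ col' (f x) = col' x.
  by have /andP[/eqP ? /eqP ?] := xchooseP (nobad_cell x).
have finj : injective f.
  by move=> x y e; apply: nobad; [rewrite -(fP x).1 e (fP y).1 | rewrite -(fP x).2 e (fP y).2].
by exists (perm finj); split=> x; rewrite permE; case: (fP x).
Qed.
End NoBadPair.
End Tableaux.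

(** * Coordinates of the canonical tableau of a partition *)

Section CanonicalTableau.
Variable m : nat.
Implicit Types (lam mu : ypart m) (k : 'I_m).

(** This is [cum] with a natural number as index, so that the end of the last row is also of this
    form. *)
Definition psum lam i := (\sum_(j < m | (j < i)%N) part_len lam j)%N.

Lemma psumS lam (i : 'I_m) : psum lam i.+1 = (psum lam i + part_len lam i)%N.
Proof.
rewrite /psum (bigD1 i) //= addnC; congr (_ + _)%N; apply: eq_bigl => j.
by rewrite ltnS -(inj_eq val_inj) /= [(j < i)%N]ltn_neqAle andbC.
Qed.

Lemma psum_le lam i i' : (i <= i')%N -> (psum lam i <= psum lam i')%N.
Proof.
move=> le; rewrite /psum [leqRHS](bigID (fun j : 'I_m => j < i)%N) /=.
rewrite [X in (_ <= X + _)%N](eq_bigl (fun j : 'I_m => j < i)%N) ?leq_addr // => j.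
by apply: andb_idl => ji; apply: leq_trans le.
Qed.

Lemma psum_total lam : psum lam m = m.
Proof.
have /andP[_ /eqP e] := valP lam; rewrite -[RHS]e big_tuple.
by apply: eq_bigl => j; rewrite ltn_ord.
Qed.

Lemma in_rowE lam (i : 'I_m) k : in_row lam i k = (psum lam i <= k < psum lam i.+1)%N.
Proof. by rewrite psumS. Qed.

Lemma in_row_ex lam k : exists i : 'I_m, in_row lam i k.
Proof.
have ex : exists i, (k < psum lam i)%N by exists m; rewrite psum_total.
case: (ex_minnP ex) => i ki mini; case: i ki mini => [|i] ki mini.
  by move: ki; rewrite /psum big_pred0.
have im : (i < m)%N by apply: mini; rewrite psum_total.
exists (Ordinal im); rewrite in_rowE /= ki andbT leqNgt.
by apply/negP=> /mini; rewrite ltnn.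
Qed.

Lemma in_row_uniq lam k i i' : in_row lam i k -> in_row lam i' k -> i = i'.
Proof.
have le j j' : in_row lam j k -> in_row lam j' k -> (j <= j')%N.
  rewrite !in_rowE => /andP[a _] /andP[_ b]; rewrite -ltnS ltnNge; apply/negP=> /(psum_le lam) h.
  by have := leq_ltn_trans (leq_trans h a) b; rewrite ltnn.
by move=> hi hi'; apply/val_inj/eqP; rewrite eqn_leq !le.
Qed.

Definition yrow lam k : 'I_m := xchoose (in_row_ex lam k).
Definition ycol lam k : nat := (k - psum lam (yrow lam k))%N.

Lemma yrowP lam k : in_row lam (yrow lam k) k.
Proof. exact: (xchooseP (in_row_ex lam k)). Qed.

Lemma in_row_yrow lam i k : in_row lam i k = (yrow lam k == i).
Proof. by apply/idP/eqP => [h|<-]; [exact: (in_row_uniq (yrowP lam k) h) | exact: yrowP]. Qed.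

Lemma same_rowE lam k k' : same_row lam k k' = (yrow lam k == yrow lam k').
Proof.
apply/existsP/eqP => [[i]|e]; first by rewrite !in_row_yrow => /andP[/eqP -> /eqP].
by exists (yrow lam k); rewrite !in_row_yrow e eqxx.
Qed.

Lemma same_colE lam k k' : same_col lam k k' = (ycol lam k == ycol lam k').
Proof.
apply/existsP/eqP => [[i /existsP[i']]|e].
  by rewrite !in_row_yrow => /and3P[/eqP <- /eqP <- /eqP].
by exists (yrow lam k); apply/existsP; exists (yrow lam k'); rewrite !yrowP /=; apply/eqP.
Qed.

Lemma part_len_mono lam (i i' : 'I_m) : (i' <= i)%N -> (part_len lam i <= part_len lam i')%N.
Proof.
have /andP[s _] := valP lam => le.
have tr : transitive geq by move=> a b c ab bc; apply: leq_trans bc ab.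
have := sorted_leq_nth tr (fun a => leqnn a) 0%N s.
move/(_ i' i); rewrite !inE size_map size_tuple => /(_ (ltn_ord _) (ltn_ord _) le).
by rewrite !(nth_map ord0) ?size_tuple // /part_len !(tnth_nth ord0).
Qed.

Lemma ycol_lt lam k : (ycol lam k < part_len lam (yrow lam k))%N.
Proof.
have := yrowP lam k; rewrite in_rowE psumS => /andP[a b].
by rewrite ltn_subLR.
Qed.

Lemma ycolK lam k : (psum lam (yrow lam k) + ycol lam k)%N = k.
Proof. by have := yrowP lam k; rewrite in_rowE => /andP[a _]; rewrite subnKC. Qed.

Lemma ytableau lam : tableau (yrow lam : 'I_m -> nat) (ycol lam).
Proof.
split=> [x y rxy cxy | y i iy].
  by apply/val_inj; rewrite /= -(ycolK lam x) -(ycolK lam y) cxy rxy.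
have im : (i < m)%N := ltn_trans iy (ltn_ord _).
(* The box of row [i] in the column of [y] carries the entry [psum lam i + ycol lam y]; it exists
   because row [i] is at least as long as the row of [y]. *)
have lt : (psum lam i + ycol lam y < psum lam i.+1)%N.
  rewrite -[i]/(nat_of_ord (Ordinal im)) psumS ltn_add2l.
  by apply: leq_trans (ycol_lt lam y) _; apply: part_len_mono; apply: ltnW.
have ltm : (psum lam i + ycol lam y < m)%N.
  by apply: leq_trans lt _; rewrite -[leqRHS](psum_total lam); apply: psum_le.
have r : yrow lam (Ordinal ltm) = Ordinal im.
  by apply/eqP; rewrite -in_row_yrow in_rowE /= leq_addr lt.
by exists (Ordinal ltm); rewrite /ycol r //= addKn.
Qed.

Lemma psum_le_size lam i : (psum lam i <= m)%N.
Proof.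
rewrite -[leqRHS](psum_total lam); have [im|/ltnW mi] := leqP i m; first exact: psum_le.
by rewrite /psum (eq_bigl (fun j : 'I_m => j < m)%N) // => j;
  rewrite ltn_ord (leq_trans (ltn_ord j)).
Qed.

Lemma rows_below_yrow lam i : rows_below (yrow lam : 'I_m -> nat) i = psum lam i.
Proof.
have le := psum_le_size lam i.
rewrite /rows_below -sum1_card (eq_bigl (fun k : 'I_m => k < psum lam i)%N).
  by rewrite (big_ord_narrow le) sum1_card card_ord.
move=> k; rewrite inE; have := yrowP lam k; rewrite in_rowE => /andP[a b].
apply/idP/idP => [ki|]; first by apply: leq_trans b _; apply: psum_le.
by rewrite !ltnNge; apply: contra => /(psum_le lam) h; apply: leq_trans a.
Qed.

Lemma ypart_eq lam mu : (forall i, psum lam i = psum mu i) -> lam = mu.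
Proof.
move=> e; apply/val_inj/eq_from_tnth => i; apply/val_inj.
by apply: (@addnI (psum lam i)); rewrite -psumS e psumS e.
Qed.

End CanonicalTableau.

(** * Young symmetrizers *)

(** Write A = C D with C left invertible and D right invertible. Cancelling the outer factors in C D
    C D = 0 leaves D C = 0, and D C has the trace of A. *)
Lemma mxtrace_sqr0 (F : fieldType) n (A : 'M[F]_n) : A *m A = 0 -> \tr A = 0.
Proof.
move=> A2; have /row_freeP[K] := row_base_free A; have /row_fullP[L] := col_base_full A.
move: (col_base A) (row_base A) (mulmx_base A) => C D CD LC DK.
rewrite -CD mxtrace_mulC; suff -> : D *m C = 0 by rewrite mxtrace0.
have e : L *m ((C *m D) *m (C *m D)) *m K = 0 by rewrite CD A2 mulmx0 mul0mx.
by move: e; rewrite !mulmxA LC mul1mx -!mulmxA DK mulmx1.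
Qed.

Section YoungSymmetrizers.
Variables (F : fieldType) (m : nat).
Hypothesis charF : [pchar F] =i pred0.
Notation A := (galg F {perm 'I_m}).
Implicit Types (lam mu : ypart m) (x y z : A) (p q s g : {perm 'I_m}).

(* In mathcomp [q * p] means p after q, so c_lam = a_lam b_lam becomes the product
   (column antisymmetrizer) * (row symmetrizer), and all modules are right modules. *)
Definition ysym lam : A := [ffun s => cl lam F s].

Lemma in_Pgrp lam p : (p \in Pgrp lam) = [forall k, yrow lam k == yrow lam (p k)].
Proof. by rewrite inE; apply: eq_forallb => k; rewrite same_rowE. Qed.

Lemma in_Qgrp lam q : (q \in Qgrp lam) = [forall k, ycol lam k == ycol lam (q k)].
Proof. by rewrite inE; apply: eq_forallb => k; rewrite same_colE. Qed.

Lemma PgrpM lam p p' : p \in Pgrp lam -> (p' * p \in Pgrp lam)%g = (p' \in Pgrp lam).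
Proof.
rewrite !in_Pgrp => /forallP h; apply: eq_forallb => k.
by rewrite permM -(eqP (h _)).
Qed.

Lemma QgrpM lam q q' : q \in Qgrp lam -> (q * q' \in Qgrp lam)%g = (q' \in Qgrp lam).
Proof.
rewrite !in_Qgrp => /forallP h; apply/forallP/forallP => h' k; last first.
  by rewrite permM (eqP (h k)).
have := h' (q^-1 k)%g; have := h (q^-1 k)%g; rewrite permM permKV => /eqP -> //.
Qed.

Lemma ysymE lam : ysym lam =
  \sum_(p in Pgrp lam) \sum_(q in Qgrp lam) (-1) ^+ odd_perm q *: delta F (q * p)%g.
Proof.
apply/ffunP=> s; rewrite !ffunE galg_sumE; apply: eq_bigr => p _.
by rewrite galg_sumE; apply: eq_bigr => q _; rewrite galg_scaleE ffunE eq_sym mulrC.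
Qed.

(** Two shapes are allowed so that products c_lam x c_mu are covered; the nonzero ones are then
    constrained by dominance. *)
Definition semi_invariant lam mu y :=
  (forall q, q \in Qgrp lam -> delta F q * y = (-1) ^+ odd_perm q *: y) /\
  (forall p, p \in Pgrp mu -> y * delta F p = y).

Lemma ysym_semi_invariant lam : semi_invariant lam lam (ysym lam).
Proof.
split=> [q qQ|p pP]; rewrite ysymE.
  rewrite mulr_sumr scaler_sumr; apply: eq_bigr => p _; rewrite mulr_sumr scaler_sumr.
  rewrite [RHS](reindex_inj (mulgI q)) /=; apply: eq_big => [q'|q' _]; first by rewrite QgrpM.
  by rewrite -scalerAr delta_mul scalerA odd_permM signr_addb mulrA -expr2 sqrr_sign mul1r mulgA.
rewrite mulr_suml [RHS](reindex_inj (mulIg p)) /=; apply: eq_big => [p'|p' _];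
  first by rewrite PgrpM.
by rewrite mulr_suml; apply: eq_bigr => q _; rewrite -scalerAl delta_mul mulgA.
Qed.

Lemma semi_invariantM lam mu lam' mu' x y z :
  semi_invariant lam mu' x -> semi_invariant lam' mu z -> semi_invariant lam mu (x * y * z).
Proof.
move=> [hx _] [_ hz]; split=> [q qQ|p pP]; first by rewrite 2!mulrA hx // !scalerAl.
by rewrite -mulrA hz.
Qed.

(** A row permutation that is also a column permutation is trivial, so only the pair (1, 1)
    contributes. *)
Lemma ysym1 lam : ysym lam 1%g = 1.
Proof.
have P1 : 1%g \in Pgrp lam by rewrite in_Pgrp; apply/forallP=> k; rewrite perm1.
have Q1 : 1%g \in Qgrp lam by rewrite in_Qgrp; apply/forallP=> k; rewrite perm1.
rewrite ffunE /cl (bigD1 1%g) //= (bigD1 1%g) //= mul1g eqxx odd_perm1 mul1r expr0.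
rewrite big1 ?addr0 => [|q /andP[_ /negPf qn]]; last by rewrite mulg1 qn mul0r.
rewrite big1 ?addr0 // => p /andP[pP pn]; rewrite big1 // => q qQ.
case: eqP => [qp|]; last by rewrite mul0r.
case/negP: pn; apply/eqP/permP=> k; rewrite perm1.
have {}qp : q (p k) = k.
  have -> : p = q^-1%g by apply/esym/eqP; rewrite eq_invg_mul; apply/eqP.
  exact: permKV.
move: pP qQ; rewrite in_Pgrp in_Qgrp => /forallP/(_ k)/eqP r /forallP/(_ (p k))/eqP c.
by apply: (ytableau lam).1; rewrite ?r // c qp.
Qed.

(** The transposition of a bad pair is a row permutation for mu, and its conjugate by [s^-1] is a
    column permutation for lam. The two invariances give y s = - y s, and 2 is invertible. *)
Lemma semi_invariant_bad_pair lam mu y s (a b : 'I_m) : semi_invariant lam mu y ->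
  a != b -> yrow mu a = yrow mu b -> ycol lam (s^-1 a)%g = ycol lam (s^-1 b)%g -> y s = 0.
Proof.
move=> [hq hp] ab rab cab; pose t := tperm a b.
have tP : t \in Pgrp mu.
  by rewrite in_Pgrp; apply/forallP=> k; rewrite /t; case: tpermP => [->|->|_ _]; rewrite ?rab.
have tQ : (t ^ s^-1)%g \in Qgrp lam.
  rewrite in_Qgrp /t tpermJ; apply/forallP=> k.
  by case: tpermP => [->|->|_ _]; rewrite ?cab.
have e1 : y (s * t^-1)%g = y s by rewrite -mul_deltaE hp.
have e2 : - y (s * t^-1)%g = y s.
  have := congr1 (fun u : A => u (s * t^-1)%g) (hq _ tQ).
  rewrite delta_mulE galg_scaleE odd_permJ odd_tperm ab expr1 mulN1r => <-; congr (y _).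
  by rewrite -conjVg conjgE invgK !mulgA mulgKV -!mulgA /t tpermV tperm2 mulg1.
move: e2; rewrite e1 => /esym/eqP; rewrite -subr_eq0 opprK -mulr2n -mulr_natl mulf_eq0.
by rewrite ((pcharf0P F).1 charF) => /eqP.
Qed.

Lemma no_bad_pair_or_zero lam mu y s : semi_invariant lam mu y -> y s != 0 ->
  forall a b : 'I_m, yrow mu a = yrow mu b :> nat ->
   ycol lam (s^-1 a)%g = ycol lam (s^-1 b)%g -> a = b.
Proof.
move=> hy ys a b /val_inj rab cab; apply/eqP; apply: contraNT ys => ab.
by rewrite (semi_invariant_bad_pair hy ab).
Qed.

Lemma tableau_comp_perm lam s :
  tableau (fun a => yrow lam (s^-1 a)%g : nat) (fun a => ycol lam (s^-1 a)%g).
Proof.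
have [inj top] := ytableau lam; split=> [a b r c|a i ia].
  by apply: (@perm_inj _ s^-1); apply: inj.
by have [b r c] := top _ _ ia; exists (s b); rewrite permK.
Qed.

Lemma rows_below_perm lam s i :
  rows_below (fun a => yrow lam (s^-1 a)%g : nat) i = psum lam i.
Proof.
rewrite -rows_below_yrow /rows_below -!sum1_card (reindex_inj (@perm_inj _ s)) /=.
by apply: eq_bigl => k; rewrite !inE permK.
Qed.

(** A nonzero coefficient at [s] excludes bad pairs between the tableau of mu and that of lam moved
    by [s]. *)
Lemma semi_invariant_dominance lam mu y : semi_invariant lam mu y -> y != 0 ->
  forall i, (psum mu i <= psum lam i)%N.
Proof.
move=> hy /eqP yn i.
have /existsP[s ys] : [exists s, y s != 0].
  rewrite -[[exists _, _]]negbK negb_exists; apply/negP => /forallP h.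
  by apply: yn; apply/ffunP=> s; rewrite ffunE; apply/eqP; have := h s; rewrite negbK.
rewrite -(rows_below_perm lam s) -rows_below_yrow.
exact: (nobad_rows_below (no_bad_pair_or_zero hy ys) (tableau_comp_perm lam s)).
Qed.

(* von Neumann's lemma: off Q P there is a bad pair, and on Q P the
   semi-invariance determines every coefficient from the one at 1. *)
Lemma semi_invariant_scalar lam y : semi_invariant lam lam y -> y = y 1%g *: ysym lam.
Proof.
move=> hy; apply/ffunP=> s; rewrite galg_scaleE.
have QP x q p : semi_invariant lam lam x -> q \in Qgrp lam -> p \in Pgrp lam ->
    s = (q * p^-1)%g -> x s = (-1) ^+ odd_perm q * x 1%g.
  move=> [hq hp] qQ pP ->; rewrite -mul_deltaE hp //.
  have := congr1 (fun u : A => u q) (hq _ qQ); rewrite delta_mulE galg_scaleE mulVg => ->.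
  by rewrite mulrA -expr2 sqrr_sign mul1r.
have main x : semi_invariant lam lam x -> x s != 0 ->
   exists q p, [/\ q \in Qgrp lam, p \in Pgrp lam & s = (q * p^-1)%g].
  move=> hx xs.
  have [|q' [hc hr]] := nobad_column_perm (no_bad_pair_or_zero hx xs) (tableau_comp_perm lam s).
    by move=> i; rewrite rows_below_perm rows_below_yrow.
  (* [q'] preserves the columns of the moved tableau and takes each entry to the moved row with the
     index of its canonical row. So its conjugate is a column permutation, [q' * s^-1] is a row
     permutation, and their quotient is [s]. *)
  exists (s * (q' * s^-1))%g, (q' * s^-1)%g; split; last by rewrite mulgK.
    by rewrite in_Qgrp; apply/forallP=> k; rewrite !permM hc permK.
  by rewrite in_Pgrp; apply/forallP=> k; rewrite permM; apply/eqP/val_inj/esym/hr.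
have [/eqP|/(main _ hy)[q [p [qQ pP e]]]] := boolP (y s == 0).
  have [/eqP|/(main _ (ysym_semi_invariant lam))[q [p [qQ pP e]]]] := boolP (ysym lam s == 0).
    by move=> -> ->; rewrite mulr0.
  rewrite (QP _ _ _ hy qQ pP e) (QP _ _ _ (ysym_semi_invariant lam) qQ pP e).
  by rewrite ysym1 mulr1 mulrC.
rewrite (QP _ _ _ hy qQ pP e) (QP _ _ _ (ysym_semi_invariant lam) qQ pP e).
by rewrite ysym1 mulr1 mulrC.
Qed.

Definition kap lam : F := (ysym lam * ysym lam) 1%g.

Lemma ysym_sqr lam : ysym lam * ysym lam = kap lam *: ysym lam.
Proof.
have h := ysym_semi_invariant lam.
by have := semi_invariant_scalar (semi_invariantM 1 h h); rewrite mulr1.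
Qed.

(** The scalar is the coefficient at 1; rotating under the trace form turns c g c into c c g = k c
    g. *)
Lemma ysym_sandwich lam g :
  ysym lam * delta F g * ysym lam = (kap lam * ysym lam g^-1%g) *: ysym lam.
Proof.
have h := ysym_semi_invariant lam.
rewrite (semi_invariant_scalar (semi_invariantM (delta F g) h h)).
congr (_ *: _); rewrite galg_tr mulrA ysym_sqr -scalerAl galg_scaleE.
by rewrite mul_deltaE mul1g.
Qed.

(** A nonzero product gives dominance one way. For the other way, nondegeneracy of the trace form
    and a rotation produce a nonzero c_mu g c_lam. Dominance both ways forces equal shapes. *)
Lemma ysym_orth lam mu x : lam != mu -> ysym lam * x * ysym mu = 0.
Proof.
move=> ne; apply/eqP; apply: contraNT ne => yn; apply/eqP/ypart_eq.
have si l l' z : semi_invariant l l' (ysym l * z * ysym l').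
  by apply: semi_invariantM; apply: ysym_semi_invariant.
have /existsP[g yg] : [exists g, (ysym lam * x * ysym mu * delta F g) 1%g != 0].
  rewrite -[[exists _, _]]negbK negb_exists; apply/negP => /forallP h.
  case/eqP: yn; apply: galg_tr_eq0 => g; apply/eqP; have := h g; by rewrite negbK.
move=> i; apply/eqP; rewrite eqn_leq (semi_invariant_dominance (si _ _ _) yn) andbT.
apply: (semi_invariant_dominance (si mu lam (delta F g))).
apply: contraNneq yg => e.
have -> : ysym lam * x * ysym mu * delta F g =
  ysym lam * (x * ysym mu * delta F g) by rewrite !mulrA.
by rewrite galg_tr -!mulrA (mulrA (ysym mu)) e mulr0 galg0E.
Qed.

(** If k = 0, the matrix [M] of right multiplication by c squares to zero, hence has trace 0; but
    its diagonal entries are c(1) = 1, so the trace is the group order. *)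
Lemma kap_neq0 lam : kap lam != 0.
Proof.
apply/eqP=> k0; have c2 := ysym_sqr lam; rewrite k0 scale0r in c2.
pose M : 'M[F]_#|{perm 'I_m}| := \matrix_(i, j) ysym lam ((enum_val i)^-1 * enum_val j)%g.
have trM : \tr M = #|{perm 'I_m}|%:R.
  rewrite /mxtrace (eq_bigr (fun=> 1)) ?sumr_const ?card_ord // => i _.
  by rewrite mxE mulVg ysym1.
have := card_neq0_char0 {perm 'I_m} charF; rewrite -trM => /eqP; apply.
apply: mxtrace_sqr0; apply/matrixP=> i j; rewrite !mxE.
have := congr1 (fun u : A => u ((enum_val i)^-1 * enum_val j)%g) c2.
rewrite galgM ffunE => e; apply: etrans e.
rewrite [RHS](reindex_inj (mulgI (enum_val i)^-1%g)) /= [RHS](reindex_onto enum_val enum_rank)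
  /=; last first.
  by move=> s _; rewrite enum_rankK.
apply: eq_big => [k|k _]; first by rewrite enum_valK eqxx.
by rewrite !mxE invMg invgK -mulgA mulKVg.
Qed.

Definition central_ysym lam : A := \sum_g delta F g^-1%g * ysym lam * delta F g.

Lemma central_ysymJ lam s g : central_ysym lam (s ^ g)%g = central_ysym lam s.
Proof.
rewrite !galg_sumE [RHS](reindex_inj (mulIg g^-1%g)) /=; apply: eq_bigr => h _.
by rewrite !mul_deltaE !delta_mulE conjgE !invMg !invgK !mulgA.
Qed.

(** Together with [ysym_central], multiplication by [ysym mu] isolates one coefficient in a
    combination of the central elements. *)
Lemma ysym_central_neq lam mu : mu != lam -> ysym mu * central_ysym lam = 0.
Proof.
move=> ne; rewrite mulr_sumr big1 // => g _.
by rewrite !mulrA ysym_orth // mul0r.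
Qed.

(** By the sandwich formula c g^-1 c g = k c(g) c g, and the sum over g is k c c. *)
Lemma ysym_central lam : ysym lam * central_ysym lam = kap lam ^+ 2 *: ysym lam.
Proof.
rewrite mulr_sumr expr2 -scalerA -ysym_sqr scalerAr.
rewrite {4}(galg_sum_delta (ysym lam)) scaler_sumr mulr_sumr; apply: eq_bigr => g _.
by rewrite !mulrA ysym_sandwich invgK -scalerAl -!scalerAr scalerA.
Qed.
End YoungSymmetrizers.

(** * Cycle types and completeness *)

Section CycleType.
Variable T : finType.
Implicit Types (s t : {perm T}) (x y : T).

Lemma perm_expg_eq s x c c' : ((s ^+ c)%g x == (s ^+ c')%g x) = (c == c' %[mod #|porbit s x|]).
Proof.
set N := #|porbit s x|.
have N0 : (0 < N)%N by apply/card_gt0P; exists x; exact: porbit_id.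
have red k : (s ^+ k)%g x = nth x (traject s x N) (k %% N).
  rewrite nth_traject ?ltn_mod // {1}(divn_eq k N) addnC permX iterD; congr (iter _ _ _).
  by elim: (k %/ N)%N => //= j IH; rewrite mulSn iterD IH iter_porbit.
by rewrite !red nth_uniq ?uniq_traject_porbit // size_traject ltn_mod.
Qed.

(** Match orbits by their position in the two lists, choose a base point in each, and send s^c
    (base) to t^c (matching base). Exponents only count modulo the orbit length, which is the same
    on both sides, so this is injective and intertwines [s] with [t]. *)
Lemma conj_porbits s t (os ot : seq {set T}) : uniq os -> uniq ot ->
  os =i porbits s -> ot =i porbits t ->
    [seq #|C| | C : {set T} <- os] = [seq #|C| | C : {set T} <- ot] ->
  exists g, t = (s ^ g)%g.
Proof.
move=> us ut hs ht e; have esz : size os = size ot by rewrite -(size_map (fun C : {set T} =>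
  #|C|)) e size_map.
(* The default [d] only makes the choice total; on an inhabited set the result does not depend on
   it. *)
pose base (C : {set T}) d := odflt d [pick y in C].
have baseP (C : {set T}) d d' y : y \in C -> base C d = base C d' /\ base C d \in C.
  by move=> yC; rewrite /base; case: pickP => [//|/(_ y)]; rewrite yC.
pose idx i := index (porbit s i) os.
have idxlt i : (idx i < size os)%N by rewrite index_mem hs imset_f.
have nth_idx i : nth set0 os (idx i) = porbit s i by rewrite nth_index // hs imset_f.
pose bs i := base (porbit s i) i; pose D i := nth set0 ot (idx i); pose bt i := base (D i) i.
have cardD i : #|D i| = #|porbit s i|.
  by rewrite -nth_idx -!(nth_map _ 0%N (fun C : {set T} => #|C|)) -?esz // e.
have bsP i : bs i \in porbit s i by case: (baseP _ i i _ (porbit_id s i)).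
have Dt i : exists y, D i = porbit t y.
  by have : D i \in porbits t; [rewrite -ht mem_nth -?esz | case/imsetP=> y _; exists y].
have btP i : bt i \in D i /\ D i = porbit t (bt i).
  have [y Dy] := Dt i; have yD : y \in D i by rewrite Dy porbit_id.
  have [_ h] := baseP _ i i _ yD; split=> //.
  by move: h; rewrite -/(bt i) {1}Dy -eq_porbit_mem Dy => /eqP.
have ex i : exists c, i == (s ^+ c)%g (bs i).
  have : i \in porbit s (bs i) by rewrite porbit_sym.
  by case/porbitP=> c e0; exists c; apply/eqP.
pose c i := xchoose (ex i).
have cP i : i = (s ^+ c i)%g (bs i) by apply/eqP; exact: (xchooseP (ex i)).
pose f i := (t ^+ c i)%g (bt i).
have orb i j : porbit s i = porbit s j -> [/\ bs i = bs j, D i = D j & bt i = bt j].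
  move=> eij; have Dij : D i = D j by rewrite /D /idx eij.
  split=> //; first by rewrite /bs eij; case: (baseP _ i j _ (porbit_id s j)).
  by rewrite /bt -Dij; case: (baseP _ i j _ (btP i).1).
have sizes i : #|porbit t (bt i)| = #|porbit s (bs i)|.
  rewrite -(btP i).2 cardD; have := bsP i; rewrite -eq_porbit_mem => /eqP -> //.
have fD i : porbit t (f i) = D i.
  by rewrite (btP i).2; apply/eqP; rewrite eq_porbit_mem; apply/porbitP; exists (c i).
have finj : injective f.
  move=> i j fij; have Dij : D i = D j by rewrite -!fD fij.
  have eij : porbit s i = porbit s j.
    rewrite -!nth_idx; congr nth; apply/eqP.
    by rewrite -(nth_uniq set0 (s := ot)) -?esz //; apply/eqP.
  have [bsij _ btij] := orb _ _ eij.
  move/eqP: fij; rewrite /f btij perm_expg_eq -btij sizes -perm_expg_eq => /eqP.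
  by rewrite -cP bsij -cP.
have fs i : f (s i) = t (f i).
  have [bsi _ bti] : [/\ bs (s i) = bs i, D (s i) = D i & bt (s i) = bt i].
    by apply: orb; apply/eqP; rewrite eq_porbit_mem; apply/porbitP; exists 1%N; rewrite expg1.
  have : (s ^+ c (s i))%g (bs i) == (s ^+ (c i).+1)%g (bs i).
    by rewrite -bsi -cP expgSr permM bsi -cP.
  rewrite perm_expg_eq -sizes -perm_expg_eq => /eqP h.
  by rewrite /f bti h expgSr permM.
exists (perm finj); apply/permP=> k.
rewrite -(permKV (perm finj) k).
by rewrite permJ !permE fs.
Qed.

Definition sorted_porbits s := sort (fun C D : {set T} => #|D| <= #|C|)%N (enum (porbits s)).
Definition porbit_sizes s := [seq #|C| | C : {set T} <- sorted_porbits s].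

Lemma mem_sorted_porbits s : sorted_porbits s =i porbits s.
Proof. by move=> C; rewrite mem_sort mem_enum. Qed.

Lemma conj_porbit_sizes s t : porbit_sizes s = porbit_sizes t -> exists g, t = (s ^ g)%g.
Proof.
by apply: conj_porbits; rewrite ?sort_uniq ?enum_uniq //; exact: mem_sorted_porbits.
Qed.

Lemma porbit_sizes_gt0 s : all (leq 1) (porbit_sizes s).
Proof.
apply/allP=> _ /mapP[C CO ->]; move: CO; rewrite mem_sorted_porbits => /imsetP[x _ ->].
by apply/card_gt0P; exists x; exact: porbit_id.
Qed.

Lemma sumn_porbit_sizes s : sumn (porbit_sizes s) = #|T|.
Proof.
rewrite sumnE big_map (perm_big (enum (porbits s))) /=; last by rewrite perm_sort.
have part : partition (porbits s) [set: T].
  rewrite (_ : porbits s = equivalence_partition (fun x y => y \in porbit s x) [set: T]).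
    apply: equivalence_partitionP => x y z _ _ _; split; first exact: porbit_id.
    by rewrite -!eq_porbit_mem => /eqP ->.
  rewrite /porbits /equivalence_partition (eq_imset _ (g := fun x =>
    [set y in [set: T] | y \in porbit s x])).
    by apply/setP=> C; apply/imsetP/imsetP=> -[x _ ->]; exists x.
  by move=> x; apply/setP=> y; rewrite !inE.
by rewrite -cardsT (card_partition part) big_enum.
Qed.

Lemma size_porbit_sizes s : (size (porbit_sizes s) <= #|T|)%N.
Proof.
rewrite -(sumn_porbit_sizes s); have := porbit_sizes_gt0 s.
by elim: (porbit_sizes s) => //= a l IH /andP[a0 /IH h]; rewrite -add1n leq_add.
Qed.

Lemma porbit_sizes_sorted s : sorted geq (porbit_sizes s).
Proof.
rewrite sorted_map; apply: sort_sorted => C D; exact: leq_total.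
Qed.
End CycleType.

(** * Cycle types as partitions *)

Section CycleTypePartition.
Variable m : nat.
Implicit Types s t : {perm 'I_m}.

Lemma mkseq_nth_pad (l : seq nat) : (size l <= m)%N ->
  mkseq (nth 0%N l) m = l ++ nseq (m - size l) 0%N.
Proof.
move=> lm; apply: (@eq_from_nth _ 0%N) => [|i].
  by rewrite size_mkseq size_cat size_nseq subnKC.
rewrite size_mkseq => im; rewrite nth_mkseq // nth_cat nth_nseq if_same.
by case: ltnP => // h; rewrite nth_default.
Qed.

Definition cycle_tuple s : m.-tuple 'I_m.+1 :=
  [tuple inord (nth 0%N (porbit_sizes s) i) | i < m].

Lemma val_cycle_tuple s :
  [seq val x | x <- cycle_tuple s] = porbit_sizes s ++ nseq (m - size (porbit_sizes s)) 0%N.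
Proof.
rewrite -mkseq_nth_pad; last by rewrite -[leqRHS]card_ord size_porbit_sizes.
rewrite /mkseq -val_enum_ord -map_comp -map_comp; apply: eq_map => i /=.
rewrite inordK // ltnS -[leqRHS](card_ord m) -(sumn_porbit_sizes s).
elim: (porbit_sizes s) (i : nat) => [|a l IH] [|j] //=; first exact: leq_addr.
by apply: leq_trans (IH j) _; exact: leq_addl.
Qed.

Lemma cycle_tuple_partn s : is_partn (cycle_tuple s).
Proof.
apply/andP; split.
  have tr : transitive geq by move=> a b c ab bc; apply: leq_trans bc ab.
  rewrite val_cycle_tuple sorted_pairwise // pairwise_cat -!sorted_pairwise //
    porbit_sizes_sorted.
  rewrite andTb; apply/andP; split; first by apply/allrelP=> a b _ /nseqP[-> _]; exact: leq0n.
  by rewrite sorted_pairwise //; elim: (m - _)%N => //= k ->; rewrite andbT;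
    apply/allP=> b /nseqP[->].
rewrite -(big_map val xpredT id) val_cycle_tuple -sumnE sumn_cat sumn_nseq mul0n addn0.
by rewrite sumn_porbit_sizes card_ord.
Qed.

Definition cycle_type s : ypart m := exist _ (cycle_tuple s) (cycle_tuple_partn s).

Lemma conj_cycle_type s t : cycle_type s = cycle_type t -> exists g, t = (s ^ g)%g.
Proof.
move=> /(congr1 (fun l : ypart m => [seq val x | x <- val l])) /=.
(* Orbit sizes are positive, so the filter removes exactly the padding zeros. *)
rewrite !val_cycle_tuple => /(congr1 (filter (leq 1))) e; apply: conj_porbit_sizes.
have f0 k : filter (leq 1) (nseq k 0%N) = [::] by elim: k.
by move: e; rewrite !filter_cat !f0 !cats0 !(all_filterP _) ?porbit_sizes_gt0.
Qed.
End CycleTypePartition.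

(** * Resolution of the identity by central elements *)

Section Completeness.
Variables (F : fieldType) (m : nat).
Hypothesis charF : [pchar F] =i pred0.

(* The z_lam are linearly independent class functions, at least as many as
   there are conjugacy classes, so they span the centre of the group algebra. *)
Lemma central_ysym_complete : exists a : ypart m -> F,
  \sum_lam a lam *: central_ysym F lam = 1.
Proof.
(* The default value is harmless: the argument only uses that each permutation is conjugate to the
   representative of its own type. *)
pose rep (mu : ypart m) := odflt 1%g [pick s | cycle_type s == mu].
have repP s : exists g, s = (rep (cycle_type s) ^ g)%g.
  apply: conj_cycle_type; rewrite /rep; case: pickP => [t /eqP //|/(_ s)].
  by rewrite eqxx.
pose M : 'M[F]_#|{: ypart m}| := \matrix_(i, j) central_ysym F (enum_val i) (rep (enum_val j)).
have class_eq (b : ypart m -> F) s :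
    (\sum_lam b lam *: central_ysym F lam) s =
      (\sum_lam b lam *: central_ysym F lam) (rep (cycle_type s)).
  have [g e] := repP s; rewrite {1}e !galg_sumE; apply: eq_bigr => lam _.
  by rewrite !galg_scaleE central_ysymJ.
have MvE (v : 'rV_#|{: ypart m}|) j :
    (v *m M) 0 j = (\sum_lam v 0 (enum_rank lam) *: central_ysym F lam) (rep (enum_val j)).
  rewrite mxE galg_sumE [RHS](reindex_onto enum_val enum_rank) /=; last by move=> l _;
    rewrite enum_rankK.
  apply: eq_big => [k|k _]; first by rewrite enum_valK eqxx.
  by rewrite galg_scaleE enum_valK mxE.
(* [M] is square because cycle types are again partitions. A vector in its kernel gives a
   combination vanishing at the representatives, hence everywhere, and each symmetrizer then kills
   one coefficient. *)
have Mu : M \in unitmx.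
  rewrite -row_free_unit; apply: inj_row_free => v v0; apply/rowP=> i; rewrite mxE.
  have z0 : \sum_lam v 0 (enum_rank lam) *: central_ysym F lam = 0.
    apply/ffunP=> s; rewrite class_eq -(enum_rankK (cycle_type s)) -MvE v0 mxE galg0E //.
  have := congr1 (fun u => ysym F (enum_val i) * u) z0; rewrite /= mulr0 mulr_sumr.
  rewrite (bigD1 (enum_val i)) //= big1 ?addr0 => [|mu ne]; last first.
    by rewrite -scalerAr ysym_central_neq ?scaler0 // eq_sym.
  rewrite -scalerAr ysym_central // enum_valK scalerA.
  move=> /(congr1 (fun u : galg F _ => u 1%g)); rewrite galg_scaleE ysym1 galg0E mulr1 => /eqP.
  by rewrite mulf_eq0 expf_eq0 (negPf (kap_neq0 charF _)) /= orbF => /eqP.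
(* The coefficients solve the linear system prescribing the values of the unit at the
   representatives. *)
pose v := (\row_j (rep (enum_val j) == 1%g)%:R : 'rV[F]_#|{: ypart m}|) *m invmx M.
exists (fun lam => v 0 (enum_rank lam)); apply/ffunP=> s.
rewrite class_eq -(enum_rankK (cycle_type s)) -MvE /v mulmxKV // mxE enum_rankK.
have [g {2}->] := repP s; rewrite ffunE; congr (_%:R); congr nat_of_bool.
by rewrite -(inj_eq (@conjg_inj _ g)) conj1g.
Qed.
End Completeness.

(** * The Coxeter presentation *)

Section Coxeter.
Variables (F : fieldType) (n m : nat) (R : 'I_n -> 'I_n -> 'I_n -> 'I_n -> F).
Notation G := (@gen_op F n R m).
Hypothesis gen_sqr : forall b, G b *m G b = 1%:M.
Hypothesis gen_braid : forall b c : 'I_m.-1, c = b.+1 :> nat ->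
  G b *m G c *m G b = G c *m G b *m G c.
Hypothesis gen_far : forall b c : 'I_m.-1, (b.+1 < c)%N -> G b *m G c = G c *m G b.
Notation wop := (@word_op F n R m).
Notation word := (seq (option 'I_m.-1)).
Implicit Types (w u v : word) (s t : {perm 'I_m}).

Lemma word_op_cat w v : wop (w ++ v) = wop v *m wop w.
Proof.
rewrite /word_op foldl_cat; elim/last_ind: v => [|v o IH]; first by rewrite /= mul1mx.
by rewrite -!cats1 !foldl_cat IH /= /compo mulmxA.
Qed.

Lemma word_perm_cat w v : word_perm (w ++ v) = (word_perm v * word_perm w)%g.
Proof.
rewrite /word_perm foldl_cat; elim/last_ind: v => [|v o IH]; first by rewrite /= mul1g.
by rewrite -!cats1 !foldl_cat IH /= mulgA.
Qed.

Lemma word_op0 : wop [::] = 1%:M. Proof. by []. Qed.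

Lemma word_perm0 : word_perm [::] = 1%g :> {perm 'I_m}. Proof. by []. Qed.

Lemma word_op1 o : wop [:: o] = letter_op R o.
Proof. by rewrite /word_op /= /compo mulmx1. Qed.

Lemma word_perm1 o : word_perm [:: o : option 'I_m.-1] = letter_perm o.
Proof. by rewrite /word_perm /= mulg1. Qed.

Lemma word_op_cons o w : wop (o :: w) = wop w *m letter_op R o.
Proof. by rewrite -cat1s word_op_cat word_op1. Qed.

Lemma word_perm_cons (o : option 'I_m.-1) w : word_perm (o :: w) =
  (word_perm w * letter_perm o)%g.
Proof. by rewrite -cat1s word_perm_cat word_perm1. Qed.

(** Tracking operator and permutation together makes each rewriting valid for both, before any map
    from permutations to operators is known to be well defined. *)
Definition word_eqv w v := wop w = wop v /\ word_perm w = word_perm v.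

Lemma word_eqv_refl w : word_eqv w w. Proof. by []. Qed.

Lemma word_eqv_sym w v : word_eqv w v -> word_eqv v w.
Proof. by case=> a b; split. Qed.

Lemma word_eqv_trans v w u : word_eqv w v -> word_eqv v u -> word_eqv w u.
Proof. by rewrite /word_eqv => -[-> ->] [-> ->]. Qed.

Lemma word_eqv_cat w w' v v' : word_eqv w w' -> word_eqv v v' -> word_eqv (w ++ v) (w' ++ v').
Proof. by move=> [a b] [c d]; rewrite /word_eqv !word_op_cat !word_perm_cat a b c d. Qed.

Lemma word_eqv_sqr b : word_eqv [:: Some b; Some b] [::].
Proof.
by rewrite /word_eqv word_op_cons word_op1 word_perm_cons word_perm1 /= gen_sqr tperm2.
Qed.

Lemma word_eqv_far b c : ((val b).+1 < val c)%N -> word_eqv [:: Some b; Some c] [:: Some c;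
  Some b].
Proof.
move=> bc; rewrite /word_eqv !word_op_cons !word_perm_cons !word_op0 !word_perm0 !mul1mx !mul1g
  /= (gen_far bc); move: bc => /= bc.
split=> //; apply: esym; apply/commgP/conjg_fixP; rewrite /adj tpermJ.
by congr tperm; apply: tpermD; rewrite -(inj_eq val_inj) /=; apply/eqP; lia.
Qed.

Lemma word_eqv_braid b c : val c = (val b).+1 ->
  word_eqv [:: Some b; Some c; Some b] [:: Some c; Some b; Some c].
Proof.
move=> bc; rewrite /word_eqv !word_op_cons !word_perm_cons !word_op0 !word_perm0 !mul1mx !mul1g
  /= (gen_braid bc); move: bc => /= bc.
split=> //; have e : pos1 c = pos2 b by apply/val_inj.
have cV (x y : 'I_m) (p : {perm 'I_m}) : (tperm x y * p * tperm x y = p ^ tperm x y)%g.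
  by rewrite conjgE tpermV mulgA.
rewrite !cV /adj !tpermJ e tpermL tpermR; congr tperm.
  by rewrite tpermD // -(inj_eq val_inj) /=; apply/eqP; lia.
by rewrite tpermD // -(inj_eq val_inj) /=; apply/eqP; lia.
Qed.

(** Natural numbers as letters keep ordinal bounds out of the straightening; a number out of range
    becomes the empty letter. *)
Definition nword (l : seq nat) : word := [seq insub k | k <- l].
Definition neqv l l' := word_eqv (nword l) (nword l').

Lemma neqv_cat l l' k k' : neqv l l' -> neqv k k' -> neqv (l ++ k) (l' ++ k').
Proof. by rewrite /neqv /nword !map_cat; exact: word_eqv_cat. Qed.

Lemma neqv_sqr k : (k < m.-1)%N -> neqv [:: k; k] [::].
Proof. by move=> km; rewrite /neqv /= insubT; exact: word_eqv_sqr. Qed.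

Lemma neqv_far k l : (k < m.-1)%N -> (l.+1 < k)%N -> neqv [:: k; l] [:: l; k].
Proof.
move=> km lk; have lm : (l < m.-1)%N by lia.
by apply: word_eqv_sym; rewrite /= !insubT; apply: word_eqv_far.
Qed.

Lemma neqv_braid k : (k.+1 < m.-1)%N -> neqv [:: k.+1; k; k.+1] [:: k; k.+1; k].
Proof.
move=> km; have lm : (k < m.-1)%N by lia.
by apply: word_eqv_sym; rewrite /= !insubT; apply: word_eqv_braid.
Qed.

Lemma neqv_far_word k l : (k < m.-1)%N -> all (fun i =>
  i.+1 < k)%N l -> neqv (k :: l) (l ++ [:: k]).
Proof.
move=> km; elim: l => [_|i l IH /= /andP[ik il]]; first exact: word_eqv_refl.
apply: (@word_eqv_trans (nword (i :: k :: l))).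
  exact: (@neqv_cat [:: k; i] [:: i; k] l l (neqv_far km ik) (word_eqv_refl _)).
exact: (@neqv_cat [:: i] [:: i] _ _ (word_eqv_refl _) (IH il)).
Qed.

(** The descending run k-1, ..., k-d: these are the minimal coset representatives of S_k in
    S_(k+1). *)
Fixpoint run (k d : nat) : seq nat :=
  match k, d with k'.+1, d'.+1 => k' :: run k' d' | _, _ => [::] end.

Lemma run0 k : run k 0 = [::]. Proof. by case: k. Qed.

Lemma run_lt k d : all (fun i => i < k)%N (run k d).
Proof.
elim: k d => [|k IH] [|d] //=; rewrite ltnSn; apply: sub_all (IH d) => i ik; exact: ltnW.
Qed.

Lemma size_run k d : (size (run k d) <= k)%N.
Proof. by elim: k d => [|k IH] [|d] //=; apply: IH. Qed.

(** A letter below the head is pushed through the tail by induction, and the head then commutes past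
    the resulting prefix. A letter equal to the head either cancels it or moves left up to the first
    two letters and braids with them, which emits one smaller letter and leaves the run intact. *)
Lemma run_push k d b : (k <= m.-1)%N -> (d <= k)%N -> (b < k)%N ->
  exists (u : seq nat) d', [/\ all (fun i =>
    i < k.-1)%N u, (d' <= k)%N & neqv (run k d ++ [:: b]) (u ++ run k d')].
Proof.
elim: k d b => // k IH [|d] b km dk bk.
  rewrite run0 /=; move: bk; rewrite ltnS leq_eqVlt orbC => /orP[lt|/eqP ->].
    by exists [:: b], 0%N; rewrite /= lt; split=> //; exact: word_eqv_refl.
  by exists [::], 1%N; split=> //=; rewrite run0; exact: word_eqv_refl.
have kk : (k < m.-1)%N by lia.
move: bk; rewrite ltnS leq_eqVlt orbC => /orP[lt|/eqP ->] /=.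
  have [u [d' [hu hd e]]] := IH d b (ltnW km) dk lt.
  exists u, d'.+1; split=> //; first by apply: sub_all hu => i /=; lia.
  apply: (@word_eqv_trans (nword (k :: u ++ run k d'))).
    exact: (@neqv_cat [:: k] [:: k] _ _ (word_eqv_refl _) e).
  rewrite /= -[k :: run _ _]cat1s catA.
  apply: (@neqv_cat (k :: u) (u ++ [:: k]) _ _ _ (word_eqv_refl _)).
  by apply: neqv_far_word => //; apply: sub_all hu => i /=; lia.
case: k d IH km dk kk => [|k] [|d] // IH km dk kk.
- by exists [::], 0%N; split=> //; exact: neqv_sqr.
- by exists [::], 0%N; split=> //; exact: neqv_sqr.
exists [:: k], d.+2; split=> //=; first by rewrite ltnSn.
apply: (@word_eqv_trans (nword ([:: k.+1; k; k.+1] ++ run k d))).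
  apply: (@neqv_cat [:: k.+1; k] [:: k.+1; k] _ (k.+1 :: run k d) (word_eqv_refl _)).
  apply: word_eqv_sym; apply: neqv_far_word => //; exact: run_lt.
exact: (neqv_cat (neqv_braid kk) (word_eqv_refl _)).
Qed.

Lemma word_normal_form k (l : seq nat) : (k <= m.-1)%N -> all (fun i => i < k)%N l ->
  exists (u : seq nat) d, [/\ all (fun i => i < k.-1)%N u, (d <= k)%N & neqv l (u ++ run k d)].
Proof.
move=> km; elim/last_ind: l => [_|l b IH].
  by exists [::], 0%N; rewrite run0; split=> //; exact: word_eqv_refl.
rewrite all_rcons => /andP[bk /IH[u [d [hu hd e]]]].
have [u' [d' [hu' hd' e']]] := run_push km hd bk.
exists (u ++ u'), d'; split=> //; first by rewrite all_cat hu.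
rewrite -cats1 -catA; apply: (@word_eqv_trans (nword ((u ++ run k d) ++ [:: b]))).
  by apply: neqv_cat => //; exact: word_eqv_refl.
by rewrite -catA; apply: neqv_cat => //; exact: word_eqv_refl.
Qed.

Lemma nword_perm_fix k l (x : 'I_m) : all (fun i => i < k)%N l -> (k < x)%N ->
  word_perm (nword l) x = x.
Proof.
move=> hl kx; elim: l hl => [_|i l IH /= /andP[ik il]]; first by rewrite /word_perm /= perm1.
rewrite word_perm_cons permM (IH il); case: insubP => [b _ bi|] /=; last by rewrite perm1.
by rewrite /adj tpermD // -(inj_eq val_inj) /= bi; apply/eqP; lia.
Qed.

Lemma run_perm k d (x : 'I_m) : (k <= m.-1)%N -> (d <= k)%N -> val x = (k - d)%N ->
  val (word_perm (nword (run k d)) x) = k.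
Proof.
elim: k d => [|k IH] [|d] km dk e; rewrite ?run0.
- by rewrite /= /word_perm /= perm1 e.
- by [].
- by rewrite /= /word_perm /= perm1 e subn0.
rewrite /= word_perm_cons permM insubT /=.
have h := IH d (ltnW km) dk e.
have -> : word_perm (nword (run k d)) x = pos1 (Ordinal km) by apply/val_inj.
by rewrite /adj tpermL.
Qed.

(** In the normal form the prefix fixes the top point while a run of length d brings the point d
    below up to it; for the identity this forces d = 0, and the induction continues with fewer
    generators. *)
Lemma nword_perm1_op k l : (k <= m.-1)%N -> all (fun i => i < k)%N l ->
  word_perm (nword l) = 1%g -> wop (nword l) = 1%:M.
Proof.
elim: k l => [|k IH] l km hl p1; first by case: l hl p1.
have [u [d [hu hd [eop eperm]]]] := word_normal_form km hl.
have d0 : d = 0%N.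
  have lt : (k.+1 - d < m)%N by lia.
  have := run_perm (x := Ordinal lt) km hd erefl.
  move: p1; rewrite eperm /nword map_cat word_perm_cat.
  move=> /(congr1 (fun p : {perm 'I_m} => val (p (Ordinal lt)))); rewrite permM perm1 /= => e1 e2.
  rewrite (nword_perm_fix hu) in e1; last by rewrite [X in (_ < X)%N]e2.
  by move: e1; rewrite e2 => e1; lia.
rewrite d0 run0 cats0 in eop eperm; rewrite eop.
by apply: IH; rewrite -?eperm //; exact: ltnW.
Qed.

Lemma word_nword w : word_eqv w (nword [seq val b | b <- pmap id w]).
Proof.
elim: w => [|o w [a b]]; first exact: word_eqv_refl.
rewrite /word_eqv word_op_cons word_perm_cons a b; case: o => [c|] /=.
  by rewrite word_op_cons word_perm_cons valK.
by rewrite mulmx1 mulg1.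
Qed.

Lemma word_perm1_op w : word_perm w = 1%g -> wop w = 1%:M.
Proof.
have [-> ->] := word_nword w; apply: (nword_perm1_op (leqnn _)).
by apply/allP=> _ /mapP[b _ ->]; exact: ltn_ord.
Qed.

Lemma word_rev_inv w : word_eqv (w ++ rev w) [::].
Proof.
elim: w => [|o w IH]; first exact: word_eqv_refl.
rewrite rev_cons -cats1 cat_cons catA.
apply: (@word_eqv_trans ([:: o] ++ [::] ++ [:: o])).
  exact: (word_eqv_cat (word_eqv_refl [:: o]) (word_eqv_cat IH (word_eqv_refl _))).
case: o => [b|]; first exact: word_eqv_sqr.
by rewrite /word_eqv /word_op /word_perm /= /compo !mulmx1 !mulg1.
Qed.

Lemma word_op_perm w v : word_perm w = word_perm v -> wop w = wop v.
Proof.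
move=> e; have [_ pv] := word_rev_inv v; have [ov _] := word_rev_inv (rev v).
have : wop (w ++ rev v) = 1%:M.
  by apply: word_perm1_op; rewrite word_perm_cat e -word_perm_cat pv.
rewrite revK word_op_cat in ov; rewrite word_op_cat => h.
by rewrite -[LHS]mul1mx -[1%:M]ov -mulmxA h mulmx1.
Qed.

(** Peel off the run that carries the preimage of the top point to the top. The length bound is
    tracked because [Ract] only searches words of length [m * m]. *)
Lemma perm_word_ex k s : (k <= m.-1)%N -> (forall x : 'I_m, (k < x)%N -> s x = x) ->
  exists l, (size l <= k * m)%N /\ word_perm (nword l) = s.
Proof.
elim: k s => [|k IH] s km hs.
  exists [::]; split=> //; apply/esym/permP=> x; rewrite perm1.
  have [x0|] := posnP x; last exact: hs.
  have [sx0|sx] := posnP (s x); first by apply/val_inj; rewrite /= x0 sx0.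
  by have /perm_inj -> := hs _ sx.
have lt : (k.+1 < m)%N by lia.
pose x0 : 'I_m := Ordinal lt; pose a := (s^-1 x0)%g.
have sa : s a = x0 by rewrite permKV.
have ak : (a <= k.+1)%N.
  rewrite leqNgt; apply/negP=> h; have e := hs _ h.
  by move: h; rewrite -e sa ltnn.
pose d := (k.+1 - a)%N; pose r := word_perm (nword (run k.+1 d)).
have ra : r a = x0.
  by apply/val_inj; rewrite run_perm // ?leq_subr // subKn.
have [|x kx|l [sz e]] := IH (r^-1 * s)%g; first exact: ltnW.
  rewrite permM; move: kx; rewrite leq_eqVlt orbC => /orP[kx|/eqP kx].
    have rx : r x = x by apply: (nword_perm_fix (run_lt _ _)).
    by rewrite -{1}rx permK hs.
  have -> : x = x0 by apply/val_inj.
  by rewrite -{1}ra permK.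
exists (l ++ run k.+1 d); split.
  by rewrite size_cat mulSn addnC leq_add // (leq_trans (size_run _ _)) // ltnW.
by rewrite /nword map_cat word_perm_cat e mulKVg.
Qed.

Lemma perm_word_full s : exists l, (size l <= m.-1 * m)%N /\ word_perm (nword l) = s.
Proof.
apply: (perm_word_ex (leqnn _)) => x xm.
by have := ltn_ord x; lia.
Qed.

(** Whichever word [Ract] picks gives the same operator, and padding with empty letters shows that
    one is found, so its fallback value never occurs. *)
Lemma RactE w : Ract R (word_perm w) = wop w.
Proof.
rewrite /Ract; case: pickP => [v /eqP h|]; first exact: word_op_perm.
have [l [sz e]] := perm_word_full (word_perm w); move=> none.
have sz' : (size (nword l) <= m * m)%N.
  by rewrite size_map (leq_trans sz) // leq_mul2r leq_pred orbT.
have pn j : word_perm (nseq j (None : option 'I_m.-1)) = 1%g.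
  by elim: j => // j IH; rewrite word_perm_cons IH mulg1.
have szv : size (nword l ++ nseq (m * m - size (nword l)) None) == (m * m)%N.
  by rewrite size_cat size_nseq subnKC.
by have := none (Tuple szv); rewrite /= word_perm_cat pn mul1g e eqxx.
Qed.

Lemma word_perm_surj s : exists w, word_perm w = s.
Proof.
by have [l [_ e]] := perm_word_full s; exists (nword l).
Qed.

Lemma RactM s t : Ract R (s * t)%g = Ract R s *m Ract R t.
Proof.
have [w <-] := word_perm_surj s; have [v <-] := word_perm_surj t.
by rewrite -word_perm_cat !RactE word_op_cat.
Qed.

Lemma Ract1 : Ract R (1%g : {perm 'I_m}) = 1%:M.
Proof. exact: (RactE [::]). Qed.

Lemma Ract_adj b : Ract R (adj b) = G b.
Proof. by rewrite -[adj b](word_perm1 (Some b)) RactE word_op1. Qed.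

Lemma Ract_word s : exists w : seq 'I_m.-1, Ract R s = wop (map Some w).
Proof.
have [w <-] := word_perm_surj s; exists (pmap id w); rewrite RactE.
elim: w => //= o w IH; rewrite word_op_cons IH; case: o => [b|] /=; last by rewrite mulmx1.
by rewrite word_op_cons.
Qed.
End Coxeter.

(** * Local operators and the braid relations *)

Section EntrywiseMatrices.
Variable F : fieldType.

Lemma mxTE (T T' : finType) (f : T -> T' -> F) x y : mxT f (enum_rank x) (enum_rank y) = f x y.
Proof. by rewrite mxE !enum_rankK. Qed.

Lemma mxTP (T T' : finType) (A B : 'M[F]_(#|T|, #|T'|)) :
  (forall x y, A (enum_rank x) (enum_rank y) = B (enum_rank x) (enum_rank y)) -> A = B.
Proof. by move=> e; apply/matrixP=> i j; rewrite -(enum_valK i) -(enum_valK j). Qed.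

Lemma mulmxTE (T T' T'' : finType) (A : 'M[F]_(#|T|, #|T'|)) (B : 'M[F]_(#|T'|, #|T''|)) x y :
  (A *m B) (enum_rank x) (enum_rank y) =
  \sum_z A (enum_rank x) (enum_rank z) * B (enum_rank z) (enum_rank y).
Proof.
rewrite mxE [RHS](reindex_onto enum_val enum_rank) /=; last by move=> z _; rewrite enum_rankK.
by apply: eq_big => [k|k _]; rewrite enum_valK ?eqxx.
Qed.

Lemma scalar1_mxTE (T : finType) (x y : T) :
  (1%:M : 'M[F]_#|T|) (enum_rank x) (enum_rank y) = (x == y)%:R.
Proof. by rewrite mxE (inj_eq enum_rank_inj). Qed.
End EntrywiseMatrices.

(** * Operators acting on chosen tensor factors *)

Section LocalOperators.
Variables (F : fieldType) (n k m : nat) (phi : 'I_k -> 'I_m).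
Hypothesis phi_inj : injective phi.
Implicit Types (I J : tens n m) (A B : op F n k).

Definition restr J : tens n k := [ffun a => J (phi a)].
Definition overwrite J (K : tens n k) : tens n m :=
  [ffun i => if [pick a | phi a == i] is Some a then K a else J i].
Definition eq_off I J := [forall i, (i \in codom phi) || (I i == J i)].

Lemma overwrite_on J (K : tens n k) a : overwrite J K (phi a) = K a.
Proof.
rewrite ffunE; case: pickP => [b /eqP/phi_inj -> //|/(_ a)]; by rewrite eqxx.
Qed.

Lemma overwrite_off J (K : tens n k) i : i \notin codom phi -> overwrite J K i = J i.
Proof.
rewrite ffunE; case: pickP => // a /eqP <- /negP[]; exact: codom_f.
Qed.

Lemma restr_overwrite J (K : tens n k) : restr (overwrite J K) = K.
Proof. by apply/ffunP=> a; rewrite ffunE overwrite_on. Qed.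

Lemma eq_offP I J : reflect (forall i, i \notin codom phi -> I i = J i) (eq_off I J).
Proof.
apply: (iffP forallP) => h i; first by move=> hi; have := h i; rewrite (negPf hi) => /eqP.
by case: (boolP (i \in codom phi)) => //= hi; rewrite h.
Qed.

Lemma eq_off_overwrite J (K : tens n k) : eq_off (overwrite J K) J.
Proof. by apply/eq_offP=> i; exact: overwrite_off. Qed.

Lemma overwrite_restr I J : eq_off I J -> overwrite J (restr I) = I.
Proof.
move=> /eq_offP h; apply/ffunP=> i; case: (boolP (i \in codom phi)) => [/codomP[a ->]|hi].
  by rewrite overwrite_on ffunE.
by rewrite overwrite_off // h.
Qed.

Lemma sum_eq_off (f : tens n m -> F) J :
  \sum_(K | eq_off K J) f K = \sum_(K : tens n k) f (overwrite J K).
Proof.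
rewrite (reindex_onto (overwrite J) restr) => [|I]; last exact: overwrite_restr.
by apply: eq_bigl => K; rewrite eq_off_overwrite restr_overwrite eqxx.
Qed.

(** The usual leg notation: [A] placed on the factors [phi 0], [phi 1], ..., in this order. *)
Definition local_op A : op F n m :=
  mxT (fun J I => A (enum_rank (restr J)) (enum_rank (restr I)) * (eq_off I J)%:R).

Lemma eq_off_trans I J (K : tens n m) : eq_off K J -> eq_off I K = eq_off I J.
Proof.
move=> /eq_offP h; apply/eq_offP/eq_offP => h' i hi; first by rewrite h' // h.
by rewrite h' // h.
Qed.

Lemma local_opM A B : local_op A *m local_op B = local_op (A *m B).
Proof.
apply: mxTP => J I; rewrite mulmxTE mxTE.
under eq_bigr => K _ do rewrite !mxTE.
rewrite (bigID (fun K => eq_off K J)) /= addrC big1 ?add0r => [|K /negPf ->];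
  last by rewrite mulr0 mul0r.
rewrite sum_eq_off mulmxTE mulr_suml; apply: eq_bigr => K _.
by rewrite eq_off_overwrite mulr1 restr_overwrite mulrA (eq_off_trans _ (eq_off_overwrite J K)).
Qed.

Lemma local_op1 : local_op 1%:M = 1%:M.
Proof.
apply: mxTP => J I; rewrite mxTE !scalar1_mxTE -natrM mulnb; congr (_%:R); congr nat_of_bool.
apply/andP/eqP => [[/eqP r o]|->]; last by split; [exact: eqxx | apply/eq_offP].
by rewrite -(overwrite_restr o) -r overwrite_restr //; apply/eq_offP.
Qed.
End LocalOperators.

Section DisjointLocalOperators.
Variables (F : fieldType) (n k k' m : nat) (phi : 'I_k -> 'I_m) (psi : 'I_k' -> 'I_m).
Hypothesis phi_inj : injective phi.
Hypothesis disj : forall a b, phi a != psi b.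

Lemma disjoint_notin b : psi b \notin codom phi.
Proof. by apply/codomP=> -[a /esym e]; have := disj a b; rewrite e eqxx. Qed.

(** A closed form symmetric in the two operators, from which commutation is visible. The only
    intermediate index that contributes agrees with [I] on the image of [phi] and with [J]
    elsewhere. *)
Lemma disjoint_local_opE (A : op F n k) (B : op F n k') (J I : tens n m) :
  (local_op phi A *m local_op psi B) (enum_rank J) (enum_rank I) =
  A (enum_rank (restr phi J)) (enum_rank (restr phi I)) *
  B (enum_rank (restr psi J)) (enum_rank (restr psi I)) *
  [forall i, [|| i \in codom phi, i \in codom psi | I i == J i]]%:R.
Proof.
rewrite mulmxTE; under eq_bigr => K _ do rewrite !mxTE.
rewrite (bigID (fun K => eq_off phi K J)) /= addrC big1 ?add0r => [|K /negPf ->];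
  last by rewrite mulr0 mul0r.
rewrite sum_eq_off // (bigD1 (restr phi I)) //= big1 ?addr0 => [|K KI].
  rewrite eq_off_overwrite mulr1 restr_overwrite // mulrA; congr (_ * _ * _%:R).
    by congr (B (enum_rank _) _); apply/ffunP=> b;
      rewrite [LHS]ffunE [RHS]ffunE overwrite_off ?disjoint_notin.
  congr nat_of_bool; apply/eq_offP/forallP => h i.
    case: (boolP (i \in codom phi)) => //= hi; case: (boolP (i \in codom psi)) => //= hi'.
    by rewrite h // overwrite_off.
  move=> hi; have := h i; rewrite (negPf hi) /=;
    case: (boolP (i \in codom phi)) => /= [/codomP[a ->] _|hi' /eqP ->].
    by rewrite overwrite_on // ffunE.
  by rewrite overwrite_off.
suff -> : eq_off psi I (overwrite phi J K) = false by rewrite !mulr0.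
apply: contraNF KI => /eq_offP h; apply/eqP/ffunP=> a; rewrite ffunE h ?overwrite_on //.
by apply/codomP=> -[b e]; have := disj a b; rewrite e eqxx.
Qed.
End DisjointLocalOperators.

Lemma local_op_comm (F : fieldType) (n k k' m : nat) (phi : 'I_k -> 'I_m) (psi : 'I_k' -> 'I_m)
    (A : op F n k) (B : op F n k') :
  injective phi -> injective psi -> (forall a b, phi a != psi b) ->
  local_op phi A *m local_op psi B = local_op psi B *m local_op phi A.
Proof.
move=> hphi hpsi disj; apply: mxTP => J I; rewrite !disjoint_local_opE //; last first.
  by move=> a b; rewrite eq_sym.
rewrite [X in X * _]mulrC; congr (_ * _%:R); congr nat_of_bool.
by apply: eq_forallb => i; rewrite orbCA.
Qed.

(** * Coxeter relations from unitarity and Yang-Baxter *)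

Section BraidRelations.
Variables (F : fieldType) (n : nat) (R : 'I_n -> 'I_n -> 'I_n -> 'I_n -> F).

Definition precomp m (J : tens n m) (s : {perm 'I_m}) : tens n m := [ffun k => J (s k)].

Lemma tau_opE m (s : {perm 'I_m}) (J I : tens n m) :
  tau_op F n s (enum_rank J) (enum_rank I) = (I == precomp J s)%:R.
Proof. exact: mxTE. Qed.

Lemma precompK m (s : {perm 'I_m}) (J : tens n m) : precomp (precomp J s) s^-1%g = J.
Proof. by apply/ffunP=> i; rewrite !ffunE permKV. Qed.

Lemma precompVK m (s : {perm 'I_m}) (J : tens n m) : precomp (precomp J s^-1%g) s = J.
Proof. by apply/ffunP=> i; rewrite !ffunE permK. Qed.

Lemma mul_tau_opE m (s : {perm 'I_m}) (A : op F n m) (J I : tens n m) :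
  (A *m tau_op F n s) (enum_rank J) (enum_rank I) =
    A (enum_rank J) (enum_rank (precomp I s^-1%g)).
Proof.
rewrite mulmxTE (bigD1 (precomp I s^-1%g)) //= big1 ?addr0 => [|K KI].
  by rewrite tau_opE precompVK eqxx mulr1.
rewrite tau_opE; case: eqP => [e|]; last by rewrite mulr0.
by rewrite e precompK eqxx in KI.
Qed.

Lemma tau_op_mulE m (s : {perm 'I_m}) (A : op F n m) (J I : tens n m) :
  (tau_op F n s *m A) (enum_rank J) (enum_rank I) = A (enum_rank (precomp J s)) (enum_rank I).
Proof.
rewrite mulmxTE (bigD1 (precomp J s)) //= big1 ?addr0 => [|K KI]; rewrite tau_opE.
  by rewrite eqxx mul1r.
by rewrite (negPf KI) mul0r.
Qed.

Lemma tau_opM m (s t : {perm 'I_m}) : tau_op F n s *m tau_op F n t = tau_op F n (t * s).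
Proof.
apply: mxTP => J I; rewrite tau_op_mulE !tau_opE; congr (_ == _)%:R.
by apply/ffunP=> i; rewrite !ffunE permM.
Qed.

Lemma tau_op1 m : tau_op F n (1 : {perm 'I_m}) = 1%:M.
Proof.
apply: mxTP => J I; rewrite tau_opE scalar1_mxTE eq_sym; congr (_ == _)%:R.
by apply/ffunP=> i; rewrite ffunE perm1.
Qed.

Lemma tau_Rop m (s : {perm 'I_m}) (a b : 'I_m) :
  tau_op F n s *m Rop R a b = Rop R (s a) (s b) *m tau_op F n s.
Proof.
apply: mxTP => J I; rewrite tau_op_mulE mul_tau_opE !mxTE !ffunE !permK.
congr (_ * _%:R); congr nat_of_bool; apply/forallP/forallP => h i.
  have := h (s^-1 i)%g; rewrite !ffunE permKV -(inj_eq (@perm_inj _ s) _ a).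
  by rewrite -(inj_eq (@perm_inj _ s) _ b) permKV.
by have := h (s i); rewrite !ffunE permK !(inj_eq (@perm_inj _ s)).
Qed.

(** The swap is applied after [R], so the two output indices occur in reversed order. *)
Lemma gen_opE m (b : 'I_m.-1) (J I : tens n m) :
  gen_op R b (enum_rank J) (enum_rank I) =
  R (I (pos2 b)) (I (pos1 b)) (J (pos1 b)) (J (pos2 b)) *
  [forall k, (k != pos1 b) && (k != pos2 b) ==> (I k == J k)]%:R.
Proof.
rewrite /gen_op /compo mul_tau_opE mxTE !ffunE tpermV tpermL tpermR.
congr (_ * _%:R); congr nat_of_bool; apply: eq_forallb => k.
case: (altP (k =P pos1 b)) => //= k1; case: (altP (k =P pos2 b)) => //= k2.
by rewrite ffunE tpermD // eq_sym.
Qed.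

(** This transports identities from two and three factors, where unitarity and the Yang-Baxter
    equation are stated. *)
Lemma local_gen_op k m (phi : 'I_k -> 'I_m) (c : 'I_k.-1) (b : 'I_m.-1) :
  injective phi -> phi (pos1 c) = pos1 b -> phi (pos2 c) = pos2 b ->
  local_op phi (gen_op R c) = gen_op R b.
Proof.
move=> hphi h1 h2; apply: mxTP => J I; rewrite mxTE !gen_opE !ffunE h1 h2 -mulrA; congr (_ * _).
rewrite -natrM mulnb; congr (_%:R); congr nat_of_bool;
  apply/andP/forallP => [[/forallP h /eq_offP o] i|h].
  case: (boolP (i \in codom phi)) => [/codomP[a ->]|hi]; last by rewrite o // eqxx implybT.
  by have := h a; rewrite !ffunE -h1 -h2 !(inj_eq hphi).
split; first by apply/forallP=> a; have := h (phi a); rewrite !ffunE -h1 -h2 !(inj_eq hphi).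
apply/eq_offP=> i hi; have := h i; case: eqP => [e|_].
  by rewrite e -h1 codom_f in hi.
by case: eqP => [e|_ /eqP //]; rewrite e -h2 codom_f in hi.
Qed.

Definition two_pos m (b : 'I_m.-1) (a : 'I_2) : 'I_m := if a == ord0 then pos1 b else pos2 b.

Lemma pos12_neq m (b : 'I_m.-1) : pos1 b != pos2 b.
Proof. by rewrite -(inj_eq val_inj) /= neq_ltn ltnSn. Qed.

Lemma two_pos_inj m (b : 'I_m.-1) : injective (@two_pos m b).
Proof.
move=> [[|[|x]] hx] [[|[|y]] hy] //; rewrite /two_pos /= => e; apply/val_inj => //=.
  by have := pos12_neq b; rewrite e eqxx.
by have := pos12_neq b; rewrite e eqxx.
Qed.

Lemma gen_op_two_pos m (b : 'I_m.-1) : gen_op R b = local_op (two_pos b) (gen_op R (m := 2) ord0).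
Proof. by rewrite (@local_gen_op 2 _ _ ord0 b) //; exact: two_pos_inj. Qed.

Lemma gen_op_far m (b c : 'I_m.-1) : (b.+1 < c)%N ->
  gen_op R b *m gen_op R c = gen_op R c *m gen_op R b.
Proof.
move=> bc; rewrite (gen_op_two_pos b) (gen_op_two_pos c); apply: local_op_comm;
  try exact: two_pos_inj.
move=> x y; rewrite /two_pos -(inj_eq val_inj); apply/eqP.
by case: (x == ord0); case: (y == ord0) => /=; lia.
Qed.

Lemma gen_op_sqr m (b : 'I_m.-1) : R_unitary R -> gen_op R b *m gen_op R b = 1%:M.
Proof.
move=> U; rewrite gen_op_two_pos local_opM; last exact: two_pos_inj.
(* Moving the inner swap across [R] turns the square into R^{21} R followed by a squared swap. *)
rewrite /gen_op /compo mulmxA -(mulmxA _ (tau_op _ _ _)) tau_Rop tpermL tpermR.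
rewrite mulmxA -mulmxA tau_opM tperm2 tau_op1 mulmx1.
have -> : pos1 (ord0 : 'I_2.-1) = inord 0 by apply/val_inj; rewrite /= inordK.
have -> : pos2 (ord0 : 'I_2.-1) = inord 1 by apply/val_inj; rewrite /= inordK.
by have := U; rewrite /R_unitary /compo => ->; apply: local_op1; exact: two_pos_inj.
Qed.

Definition three_pos m (b c : 'I_m.-1) (a : 'I_3) : 'I_m :=
  if val a == 0%N then pos1 b else if val a == 1%N then pos2 b else pos2 c.

Lemma three_pos_inj m (b c : 'I_m.-1) : c = b.+1 :> nat -> injective (three_pos b c).
Proof.
move=> bc [[|[|[|x]]] hx] [[|[|[|y]]] hy] // /(congr1 val); rewrite /three_pos /= => e;
  apply/val_inj => //=; lia.
Qed.

Lemma gen_op_braid m (b c : 'I_m.-1) : qybe R -> c = b.+1 :> nat ->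
  gen_op R b *m gen_op R c *m gen_op R b = gen_op R c *m gen_op R b *m gen_op R c.
Proof.
move=> Y bc; have inj := three_pos_inj bc.
pose x0 : 'I_3 := inord 0; pose x1 : 'I_3 := inord 1; pose x2 : 'I_3 := inord 2.
have e1 : pos1 (ord0 : 'I_3.-1) = x0 by apply/val_inj; rewrite /= inordK.
have e2 : pos2 (ord0 : 'I_3.-1) = x1 by apply/val_inj; rewrite /= inordK.
have e3 : pos1 (ord_max : 'I_3.-1) = x1 by apply/val_inj; rewrite /= inordK.
have e4 : pos2 (ord_max : 'I_3.-1) = x2 by apply/val_inj; rewrite /= inordK.
have Gb : local_op (three_pos b c) (gen_op R (m := 3) ord0) = gen_op R b.
  by apply: local_gen_op.
have Gc : local_op (three_pos b c) (gen_op R (m := 3) ord_max) = gen_op R c.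
  by apply: local_gen_op => //; apply/val_inj; rewrite /= bc.
rewrite -Gb -Gc !local_opM //; congr (local_op _ _).
have n01 : x0 != x1 by rewrite -(inj_eq val_inj) /= !inordK.
have n02 : x0 != x2 by rewrite -(inj_eq val_inj) /= !inordK.
have n12 : x1 != x2 by rewrite -(inj_eq val_inj) /= !inordK.
have n10 : x1 != x0 by rewrite eq_sym.
have n20 : x2 != x0 by rewrite eq_sym.
have n21 : x2 != x1 by rewrite eq_sym.
rewrite /gen_op /compo /adj e1 e2 e3 e4.
set t0 := tperm x0 x1; set t1 := tperm x1 x2.
have s0 u v : tau_op F n t0 *m Rop R u v = Rop R (t0 u) (t0 v) *m tau_op F n t0 by exact: tau_Rop.
have s1 u v : tau_op F n t1 *m Rop R u v = Rop R (t1 u) (t1 v) *m tau_op F n t1 by exact: tau_Rop.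
have [t00 t01 t02] : [/\ t0 x0 = x1, t0 x1 = x0 & t0 x2 = x2] by rewrite /t0 tpermL tpermR tpermD.
have [t10 t11 t12] : [/\ t1 x0 = x0, t1 x1 = x2 & t1 x2 = x1] by rewrite /t1 tpermL tpermR tpermD.
(* All swaps are moved to the right end: the [R] factors become one side of the Yang-Baxter
   equation, and the swaps one side of the braid relation in S_3. *)
transitivity (Rop R x0 x1 *m (Rop R x0 x2 *m Rop R x1 x2) *m
   (tau_op F n t0 *m (tau_op F n t1 *m tau_op F n t0))).
  rewrite -!mulmxA; congr (_ *m _).
  by rewrite !mulmxA s0 t01 t02 -!mulmxA; congr (_ *m _);
     rewrite !mulmxA -(mulmxA _ (tau_op _ _ t1)) s1 t10 t11 !mulmxA s0 t00 t02.
transitivity (Rop R x1 x2 *m (Rop R x0 x2 *m Rop R x0 x1) *m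
   (tau_op F n t1 *m (tau_op F n t0 *m tau_op F n t1))); last first.
  apply: esym; rewrite -!mulmxA; congr (_ *m _).
  by rewrite !mulmxA s1 t10 t11 -!mulmxA; congr (_ *m _);
     rewrite !mulmxA -(mulmxA _ (tau_op _ _ t0)) s0 t01 t02 !mulmxA s1 t10 t12.
rewrite !tau_opM; congr (_ *m tau_op _ _ _); first exact: (esym Y).
have cV (p q : {perm 'I_3}) (u v : 'I_3) : p = tperm u v -> (p * q * p = q ^ p)%g.
  by move=> ->; rewrite conjgE tpermV mulgA.
rewrite (cV _ _ _ _ (erefl t0)) (cV _ _ _ _ (erefl t1)) /t0 /t1 !tpermJ -/t0 -/t1.
by rewrite t01 t02 t10 t11.
Qed.
End BraidRelations.

(** * The commutant of the R-permutation action *)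

Section MonomialWords.
Variables (n m : nat).
Notation Lgen := (Lgen n).
Implicit Types (I J : tens n m) (b : 'I_m.-1).

Definition pair_tens (k1 k2 : 'I_n) : tens n 2 := [ffun a => if a == ord0 then k1 else k2].

Lemma sum_pair_tens (V : zmodType) (f : tens n 2 -> V) :
  \sum_K f K = \sum_k1 \sum_k2 f (pair_tens k1 k2).
Proof.
rewrite pair_big /= (reindex (fun p => pair_tens p.1 p.2)) //=.
exists (fun K : tens n 2 => (K ord0, K ord_max)) => [[k1 k2] _|K _] /=; first by rewrite !ffunE.
apply/ffunP=> a; rewrite ffunE; case: eqP => [-> //|a0].
by congr (K _); apply/val_inj; case: a a0 => [[|[|a]] ha] //= a0; case: a0; apply/val_inj.
Qed.

Lemma overwrite_pos1 b J k1 k2 : overwrite (two_pos b) J (pair_tens k1 k2) (pos1 b) = k1.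
Proof. by rewrite -[pos1 b]/(two_pos b ord0) overwrite_on ?ffunE //; exact: two_pos_inj. Qed.

Lemma overwrite_pos2 b J k1 k2 : overwrite (two_pos b) J (pair_tens k1 k2) (pos2 b) = k2.
Proof. by rewrite -[pos2 b]/(two_pos b ord_max) overwrite_on ?ffunE //; exact: two_pos_inj. Qed.

Lemma overwrite_other b J K (i : 'I_m) : i != pos1 b -> i != pos2 b ->
  overwrite (two_pos b) J K i = J i.
Proof.
move=> i1 i2; apply: overwrite_off; apply/codomP=> -[a].
by rewrite /two_pos; case: ifP => _ e; [rewrite e eqxx in i1 | rewrite e eqxx in i2].
Qed.

Lemma overwrite_twice b J K K' :
  overwrite (two_pos b) (overwrite (two_pos b) J K) K' = overwrite (two_pos b) J K'.
Proof.
apply/ffunP=> i; have [/codomP[a ->]|hi] := boolP (i \in codom (two_pos b)).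
  by rewrite !overwrite_on //; exact: two_pos_inj.
by rewrite !overwrite_off.
Qed.

Lemma size_monoIJ I J : size (monoIJ I J) = m.
Proof. by rewrite size_map size_enum_ord. Qed.

Lemma nth_monoIJ x0 I J (i : 'I_m) : nth x0 (monoIJ I J) i = (I i, J i).
Proof. by rewrite (nth_map i) ?size_enum_ord // nth_ord_enum. Qed.

(** The bridge between matrices and words: an operator on two adjacent factors affects two adjacent
    letters, which is the shape of the relations of H_R. *)
Lemma monoIJ_overwrite b I J k1 k2 l1 l2 :
  monoIJ (overwrite (two_pos b) I (pair_tens k1 k2)) (overwrite (two_pos b) J (pair_tens l1 l2)) =
  take b (monoIJ I J) ++ [:: (k1, l1); (k2, l2)] ++ drop b.+2 (monoIJ I J).
Proof.
have bm := ltn_ord b; have x0 := (k1, l1).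
have sb : size (take b (monoIJ I J)) = b by rewrite size_take size_monoIJ; case: ltnP; lia.
apply: (@eq_from_nth _ x0) => [|i].
  by rewrite !size_cat sb size_drop !size_monoIJ /=; lia.
rewrite size_monoIJ => im; rewrite -[i]/(nat_of_ord (Ordinal im)) nth_monoIJ nth_cat sb /=.
case: ltnP => ib.
  rewrite nth_take // -[i]/(nat_of_ord (Ordinal im)) nth_monoIJ.
  by rewrite !overwrite_other // -(inj_eq val_inj) /=; apply/eqP; lia.
have [e|ne] := eqVneq i b.
  have -> : Ordinal im = pos1 b by apply/val_inj.
  by rewrite e subnn /= !overwrite_pos1.
have [e|ne2] := eqVneq i b.+1.
  have -> : Ordinal im = pos2 b by apply/val_inj.
  by rewrite e subSnn /= !overwrite_pos2.
have -> : (i - b = (i - b.+2).+2)%N by move/eqP: ne; move/eqP: ne2; lia.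
rewrite /= nth_drop subnKC; last by move/eqP: ne; move/eqP: ne2; lia.
rewrite -[i in RHS]/(nat_of_ord (Ordinal im)) nth_monoIJ.
by rewrite !overwrite_other // -(inj_eq val_inj) /=; apply/eqP; move/eqP: ne; move/eqP: ne2; lia.
Qed.

Definition word_out (t : m.-tuple Lgen) : tens n m := [ffun k => (tnth t k).1].
Definition word_in (t : m.-tuple Lgen) : tens n m := [ffun k => (tnth t k).2].

Lemma monoIJ_word (t : m.-tuple Lgen) : monoIJ (word_out t) (word_in t) = t.
Proof.
rewrite -[RHS]map_tnth_enum; apply: eq_map => k; rewrite !ffunE.
by case: (tnth t k).
Qed.

Lemma word_monoIJ I J (t : m.-tuple Lgen) : tval t = monoIJ I J ->
  word_out t = I /\ word_in t = J.
Proof.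
by move=> e; split; apply/ffunP=> k; rewrite ffunE (tnth_nth (I k, J k)) e nth_monoIJ.
Qed.
End MonomialWords.

(** * Relations of H_R as commutation with the generators *)

Section FRTCommutant.
Variables (F : fieldType) (n m : nat) (R : 'I_n -> 'I_n -> 'I_n -> 'I_n -> F).
Notation G := (@gen_op F n R m).
Implicit Types (A : op F n m) (I J : tens n m).

Lemma gen_op2E (K L : tens n 2) :
  gen_op R (m := 2) ord0 (enum_rank K) (enum_rank L) =
    R (L ord_max) (L ord0) (K ord0) (K ord_max).
Proof.
have e1 : pos1 (ord0 : 'I_2.-1) = ord0 by apply/val_inj.
have e2 : pos2 (ord0 : 'I_2.-1) = ord_max by apply/val_inj.
rewrite gen_opE e1 e2 (_ : [forall k, _] = true) ?mulr1 //.
by apply/forallP=> -[[|[|k]] hk].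
Qed.

Lemma gen_mulE A (b : 'I_m.-1) J I :
  (G b *m A) (enum_rank J) (enum_rank I) =
  \sum_k1 \sum_k2 R k2 k1 (J (pos1 b)) (J (pos2 b)) *
     A (enum_rank (overwrite (two_pos b) J (pair_tens k1 k2))) (enum_rank I).
Proof.
rewrite gen_op_two_pos mulmxTE; under eq_bigr => K _ do rewrite mxTE.
rewrite (bigID (fun K => eq_off (two_pos b) K J)) /= addrC big1 ?add0r => [|K /negPf ->];
  last by rewrite mulr0 mul0r.
have inj := @two_pos_inj m b.
rewrite sum_eq_off // sum_pair_tens; apply: eq_bigr => k1 _; apply: eq_bigr => k2 _.
by rewrite eq_off_overwrite mulr1 restr_overwrite // gen_op2E !ffunE.
Qed.

Lemma mul_genE A (b : 'I_m.-1) J I :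
  (A *m G b) (enum_rank J) (enum_rank I) =
  \sum_k1 \sum_k2 A (enum_rank J) (enum_rank (overwrite (two_pos b) I (pair_tens k1 k2))) *
     R (I (pos2 b)) (I (pos1 b)) k1 k2.
Proof.
have off_sym K L : eq_off (two_pos b) K L = eq_off (two_pos b) L K :> bool.
  by apply: eq_forallb => i; rewrite eq_sym.
rewrite gen_op_two_pos mulmxTE; under eq_bigr => K _ do rewrite mxTE off_sym.
rewrite (bigID (fun K => eq_off (two_pos b) K I)) /= addrC big1 ?add0r => [|K /negPf ->];
  last by rewrite !mulr0.
have inj := @two_pos_inj m b.
rewrite sum_eq_off // sum_pair_tens; apply: eq_bigr => k1 _; apply: eq_bigr => k2 _.
by rewrite eq_off_overwrite mulr1 restr_overwrite // gen_op2E !ffunE.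
Qed.

Lemma HR_commutes A b : HR R A -> A *m G b = G b *m A.
Proof.
case=> f [hf ->]; apply: mxTP => J I; rewrite gen_mulE mul_genE.
have own (L : tens n m) : L = overwrite (two_pos b) L (pair_tens (L (pos1 b)) (L (pos2 b))).
  apply/ffunP=> i; have [->|n1] := eqVneq i (pos1 b); first by rewrite overwrite_pos1.
  by have [->|n2] := eqVneq i (pos2 b); rewrite ?overwrite_pos2 // overwrite_other.
(* Prefix and suffix are the letters away from [b] and [b.+1]; the two row indices are exchanged
   because of the swap in the generator. *)
have := hf (take b (monoIJ I J)) (drop b.+2 (monoIJ I J)) (I (pos2 b)) (I (pos1 b))
  (J (pos1 b)) (J (pos2 b)).
have e1 k1 k2 : take b (monoIJ I J) ++ [:: (k1, J (pos1 b));
  (k2, J (pos2 b))] ++ drop b.+2 (monoIJ I J)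
   = monoIJ (overwrite (two_pos b) I (pair_tens k1 k2)) J.
  by have := monoIJ_overwrite b I J k1 k2 (J (pos1 b)) (J (pos2 b)); rewrite -(own J) => ->.
have e2 k1 k2 : take b (monoIJ I J) ++ [:: (I (pos1 b), k1);
  (I (pos2 b), k2)] ++ drop b.+2 (monoIJ I J)
   = monoIJ I (overwrite (two_pos b) J (pair_tens k1 k2)).
  by have := monoIJ_overwrite b I J (I (pos1 b)) (I (pos2 b)) k1 k2; rewrite -(own I) => ->.
rewrite [X in _ = X]exchange_big /= => h.
transitivity (\sum_k1 \sum_k2 R (I (pos2 b)) (I (pos1 b)) k1 k2 *
  f (take b (monoIJ I J) ++ [:: (k1, J (pos1 b)); (k2, J (pos2 b))] ++ drop b.+2 (monoIJ I J))).
  by apply: eq_bigr => k1 _; apply: eq_bigr => k2 _; rewrite mxTE e1 mulrC.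
rewrite h; apply: eq_bigr => k1 _; apply: eq_bigr => k2 _.
by rewrite mxTE mulrC -e2.
Qed.

(** Words of length m correspond to pairs (I, J), so the entries of A define a functional on them.
    It is extended by 0 to other lengths, which is consistent because the relations are
    homogeneous. *)
Lemma commutes_HR A : (forall b, A *m G b = G b *m A) -> HR R A.
Proof.
move=> hA; pose f (w : seq (Lgen n)) :=
  if insub w is Some t then A (enum_rank (word_in (t : m.-tuple _)))
    (enum_rank (word_out t)) else 0.
have fE I J : f (monoIJ I J) = A (enum_rank J) (enum_rank I).
  rewrite /f; case: insubP => [t _ e|]; last by rewrite size_monoIJ eqxx.
  by have [-> ->] := word_monoIJ e.
exists f; split; last by apply: mxTP => J I; rewrite mxTE fE.
move=> u v i1 i2 j1 j2.
have [sz|sz] := eqVneq (size u + (size v).+2)%N m; last first.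
  have f0 x y : f (u ++ [:: x; y] ++ v) = 0.
    rewrite /f insubF //; apply: contraNF sz; rewrite size_cat; exact: id.
  rewrite !big1 // => k1 _; rewrite big1 // => k2 _.
    by rewrite f0 mul0r.
  by rewrite f0 mulr0.
have ltb : (size u < m.-1)%N by lia.
pose b := Ordinal ltb.
(* This word serves to read off multi-indices from [u] and [v]; its two middle letters are
   overwritten in [ow]. *)
have szw : size (u ++ [:: (i2, j1); (i1, j2)] ++ v) == m by rewrite size_cat /= sz.
have mE := monoIJ_word (Tuple szw); rewrite /= in mE.
set I0 := word_out _ in mE; set J0 := word_in _ in mE.
have ow k1 k2 l1 l2 : monoIJ (overwrite (two_pos b) I0 (pair_tens k1 k2))
  (overwrite (two_pos b) J0 (pair_tens l1 l2)) =
    u ++ [:: (k1, l1); (k2, l2)] ++ v.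
  rewrite monoIJ_overwrite mE /= take_size_cat //; congr (_ ++ [:: _, _ & _]).
  by rewrite -[(size u).+2]/(2 + size u)%N -drop_drop drop_size_cat //= drop0.
pose I := overwrite (two_pos b) I0 (pair_tens i2 i1).
pose J := overwrite (two_pos b) J0 (pair_tens j1 j2).
have := congr1 (fun B : op F n m => B (enum_rank J) (enum_rank I)) (hA b).
rewrite /= gen_mulE mul_genE !overwrite_pos1 !overwrite_pos2 => h.
transitivity (\sum_k1 \sum_k2 A (enum_rank J)
  (enum_rank (overwrite (two_pos b) I (pair_tens k1 k2))) * R i1 i2 k1 k2).
  apply: eq_bigr => k1 _; apply: eq_bigr => k2 _.
  by rewrite mulrC -fE /I overwrite_twice ow.
rewrite h exchange_big /=; apply: eq_bigr => k1 _; apply: eq_bigr => k2 _.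
by rewrite mulrC -fE /J overwrite_twice ow.
Qed.
End FRTCommutant.

(** * Schur-Weyl duality *)

Section SchurWeyl.
Variables (F : fieldType) (n m : nat) (R : 'I_n -> 'I_n -> 'I_n -> 'I_n -> F).
Hypothesis charF : [pchar F] =i pred0.
Hypothesis unitR : R_unitary R.
Hypothesis qybeR : qybe R.
Notation A := (galg F {perm 'I_m}).
Notation N := #|tens n m|.
Implicit Types (x y : A) (g s : {perm 'I_m}) (lam mu : ypart m) (X B : op F n m).

Let gsqr (b : 'I_m.-1) := gen_op_sqr b unitR.
Let gbraid (b c : 'I_m.-1) (e : c = b.+1 :> nat) := gen_op_braid qybeR e.
Let gfar (b c : 'I_m.-1) (lt : (b.+1 < c)%N) := gen_op_far R lt.
Notation rho s := (Ract R s : op F n m).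

Let rhoM s g : rho (s * g)%g = rho s *m rho g.
Proof. exact: RactM gsqr gbraid gfar s g. Qed.
Let rho1 : rho 1%g = 1%:M.
Proof. exact: Ract1 gsqr gbraid gfar. Qed.

Definition act x : op F n m := \sum_s x s *: rho s.

Lemma actZ a x : act (a *: x) = a *: act x.
Proof. by rewrite scaler_sumr; apply: eq_bigr => s _; rewrite galg_scaleE scalerA. Qed.

Lemma act_sum I (r : seq I) (P : pred I) (f : I -> A) :
  act (\sum_(i <- r | P i) f i) = \sum_(i <- r | P i) act (f i).
Proof.
rewrite /act exchange_big /=; apply: eq_bigr => s _.
by rewrite galg_sumE scaler_suml.
Qed.

Lemma act_delta g : act (delta F g) = rho g.
Proof.
rewrite /act (bigD1 g) //= big1 ?addr0 => [|s /negPf sg]; rewrite ffunE ?eqxx ?scale1r //.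
by rewrite sg scale0r.
Qed.

Lemma act1 : act 1 = 1%:M.
Proof. by rewrite -delta1E act_delta rho1. Qed.

Lemma act0 : act 0 = 0.
Proof. by rewrite /act big1 // => s _; rewrite ffunE scale0r. Qed.

Lemma actM x y : act (x * y) = act x *m act y.
Proof.
rewrite {1}(galg_sum_delta x) {1}(galg_sum_delta y) mulr_suml act_sum [in RHS]/act mulmx_suml.
apply: eq_bigr => s _; rewrite mulr_sumr act_sum mulmx_sumr; apply: eq_bigr => g _.
by rewrite -scalerAl -scalerAr !actZ delta_mul act_delta rhoM -scalemxAl -scalemxAr.
Qed.

Lemma SR_act B : SR R B <-> exists x, B = act x.
Proof.
split=> [[ws [cs ->]]|[x ->]].
  exists (\sum_(i < size ws) cs`_i *: delta F (word_perm (map Some (nth [::] ws i)))).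
  rewrite act_sum; apply: eq_bigr => i _; rewrite actZ act_delta; congr (_ *: _).
  by rewrite (RactE gsqr gbraid gfar).
have ex s : exists w : seq 'I_m.-1, rho s == word_op R (map Some w).
  by have [w ->] := Ract_word gsqr gbraid gfar s; exists w.
pose l := index_enum {perm 'I_m}.
exists [seq xchoose (ex s) | s <- l], [seq x s | s <- l].
rewrite size_map /act -/l (big_nth 1%g) big_mkord; apply: eq_bigr => i _.
by rewrite !(nth_map 1%g) // -(eqP (xchooseP (ex _))).
Qed.

Lemma HR_rho B : HR R B <-> forall s, B *m rho s = rho s *m B.
Proof.
split=> [hB s|hB]; last first.
  by apply: commutes_HR => b; rewrite -(Ract_adj gsqr gbraid gfar).
have [w ->] := Ract_word gsqr gbraid gfar s.
elim: w => [|b w IH]; first by rewrite mulmx1 mul1mx.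
have e : B *m letter_op R (Some b) = letter_op R (Some b) *m B := HR_commutes b hB.
by rewrite map_cons word_op_cons mulmxA IH -mulmxA e mulmxA.
Qed.

Lemma HR_act B x : HR R B -> B *m act x = act x *m B.
Proof.
move=> /HR_rho hB; rewrite mulmx_sumr mulmx_suml; apply: eq_bigr => s _.
by rewrite -scalemxAr -scalemxAl hB.
Qed.

Notation C lam := (act (ysym F lam)).
Notation k lam := (kap F lam).

Lemma cR_act lam : cR R lam = C lam.
Proof. by apply: eq_bigr => s _; rewrite ffunE. Qed.

Lemma C_sqr lam : C lam *m C lam = k lam *: C lam.
Proof. by rewrite -actM ysym_sqr // actZ. Qed.

Lemma C_sandwich lam g : C lam *m rho g *m C lam = (k lam * ysym F lam g^-1%g) *: C lam.
Proof. by rewrite -act_delta -!actM ysym_sandwich // actZ. Qed.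

Lemma C_orth lam mu g : lam != mu -> C lam *m rho g *m C mu = 0.
Proof. by move=> ne; rewrite -act_delta -!actM ysym_orth // act0. Qed.

Definition average X : op F n m := \sum_g rho g^-1%g *m X *m rho g.

Lemma HR_average X : HR R (average X).
Proof.
apply/HR_rho=> s; rewrite mulmx_suml mulmx_sumr [RHS](reindex_inj (mulIg s)) /=.
by apply: eq_bigr => g _; rewrite -!mulmxA -rhoM !mulmxA -rhoM invMg mulKVg.
Qed.

(** Multiply by k and use k u E = u c E = u E c. Since v g c = k c(g^-1) v, every summand becomes a
    multiple of v, and the multiples add up to k (u c phi) = k^2 (u phi). *)
Lemma average_rank1 lam (u v : 'rV[F]_N) (phi : 'cV[F]_N) :
  u *m C lam = k lam *: u -> v *m C lam = k lam *: v ->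
  u *m average (phi *m v) = (k lam * (u *m phi) 0 0) *: v.
Proof.
move=> hu hv; have k0 := kap_neq0 charF lam.
apply: (scalerI k0); rewrite scalemxAl -hu -mulmxA -(HR_act _ (HR_average _)) mulmxA.
have vgC g : v *m rho g *m C lam = (k lam * ysym F lam g^-1%g) *: v.
  apply: (scalerI k0).
  by rewrite !scalemxAl -hv -!mulmxA (mulmxA (C lam)) C_sandwich -scalemxAr hv !scalerA mulrC.
rewrite [u *m average _]mulmx_sumr mulmx_suml scalerA.
have -> : k lam * (k lam * (u *m phi) 0 0) =
  \sum_g k lam * ysym F lam g^-1%g * (u *m rho g^-1%g *m phi) 0 0.
  rewrite -[k lam * (u *m phi) 0 0](_ : (u *m C lam *m phi) 0 0 = _);
    last by rewrite hu -scalemxAl mxE.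
  rewrite /act mulmx_sumr mulmx_suml summxE mulr_sumr (reindex_inj invg_inj) /=.
  by apply: eq_bigr => g _; rewrite -scalemxAr -scalemxAl mxE mulrA.
rewrite scaler_suml; apply: eq_bigr => g _.
rewrite !mulmxA -(mulmxA _ v) -(mulmxA _ (v *m _)) vgC -scalemxAr [X in X *m _]mx11_scalar.
by rewrite mul_scalar_mx scalerA.
Qed.

Lemma row_C lam i : row i (C lam) *m C lam = k lam *: row i (C lam).
Proof. by rewrite -row_mul C_sqr linearZ. Qed.

(** Take phi to be a coordinate at which u does not vanish: every row v of [C lam] is then a nonzero
    multiple of u E(phi v), which stays in U. *)
Lemma C_sub_HR_stable lam r (U : 'M[F]_(r, N)) (u : 'rV[F]_N) :
  (forall B, HR R B -> (U *m B <= U)%MS) -> (u <= U)%MS -> u != 0 -> u *m C lam = k lam *: u ->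
  (C lam <= U)%MS.
Proof.
move=> hU uU /rV0Pn[j uj] uC; apply/row_subP=> i; set v := row i _.
have e := average_rank1 (delta_mx j 0) uC (row_C lam i); rewrite -/v in e.
have a0 : k lam * (u *m delta_mx j 0 : 'M_1) 0 0 != 0.
  by rewrite mulf_neq0 ?kap_neq0 // -colE mxE.
rewrite -[v](scalerK a0) -e scalemx_sub //.
by apply: submx_trans (hU _ (HR_average _)); exact: submxMr.
Qed.

Lemma C_irreducible lam : (0 < \rank (C lam))%N -> irreducible_for (@HR F n R m) (C lam).
Proof.
move=> r0; split=> // U UC hU; have [->|/rowV0Pn[u uU u0]] := eqVneq U 0;
  first by rewrite mxrank0; left.
right; rewrite /eqmx UC /=; apply: (C_sub_HR_stable hU uU u0).
have /submxP[D ->] := submx_trans uU UC.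
by rewrite -mulmxA C_sqr scalemxAr.
Qed.

Lemma SR_bicommutant B : (forall H, HR R H -> compo B H = compo H B) -> SR R B.
Proof.
move=> hB.
(* The coefficient element y is read off from one vector u of the image of C lam,
   so it serves all of that image simultaneously. *)
have key lam (D : op F n m) : (forall H, HR R H -> compo D H = compo H D) ->
    exists y, C lam *m D = act y.
  move=> hD; have [->|/rowV0Pn[u uC u0]] := eqVneq (C lam) 0.
    by exists 0; rewrite mul0mx act0.
  have uk : u *m C lam = k lam *: u.
    by have /submxP[E ->] := uC; rewrite -mulmxA C_sqr scalemxAr.
  have /rV0Pn[j uj] := u0.
  pose phi : 'cV[F]_N := delta_mx j 0.
  have a0 : k lam * (u *m phi) 0 0 != 0 by rewrite mulf_neq0 ?kap_neq0 // -colE mxE.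
  pose y : A := [ffun g => (u *m D *m rho g^-1%g *m phi) 0 0].
  exists ((k lam * (u *m phi) 0 0)^-1 *: (ysym F lam * y)).
  apply/row_matrixP=> i; set v := row i (C lam).
  rewrite row_mul -/v actZ actM linearZ /= row_mul -/v.
  (* Applying u E(phi v) D = u D E(phi v) gives k (u phi) v D on the left and, on the right, the sum
     of (u D g^-1 phi) v g, whose coefficients do not involve v. *)
  have := congr1 (mulmx u) (hD _ (HR_average (phi *m v))); rewrite /compo !mulmxA.
  rewrite (average_rank1 phi uk (row_C lam i)) -/v -scalemxAl => e.
  rewrite -[v *m D](scalerK a0) e; congr (_ *: _).
  rewrite /average /act !mulmx_sumr; apply: eq_bigr => g _.
  rewrite ffunE !mulmxA -(mulmxA _ v) [X in X *m _]mx11_scalar mul_scalar_mx.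
  by rewrite -scalemxAr.
have [a ha] := central_ysym_complete m charF.
(* After the resolution of 1 is inserted on the left, each [rho g *m B] still commutes with HR_m, so
   [key] applies to it. *)
have -> : B = \sum_lam a lam *: \sum_g rho g^-1%g *m (C lam *m (rho g *m B)).
  rewrite -[LHS]mul1mx -act1 -ha act_sum mulmx_suml; apply: eq_bigr => lam _.
  rewrite actZ -scalemxAl act_sum mulmx_suml; congr (_ *: _); apply: eq_bigr => g _.
  by rewrite !actM !act_delta !mulmxA.
have sum_act I (f : I -> op F n m) (l : seq I) : (forall i, exists y, f i = act y) ->
    exists y, \sum_(i <- l) f i = act y.
  move=> h; elim: l => [|i l [y e]]; first by exists 0; rewrite big_nil act0.
  have [z ez] := h i; exists (z + y); rewrite big_cons e ez /act -big_split /=.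
  by apply: eq_bigr => s _; rewrite galgDE scalerDl.
apply/SR_act/sum_act => lam.
have [y ->] : exists y, \sum_g rho g^-1%g *m (C lam *m (rho g *m B)) = act y; last first.
  by exists (a lam *: y); rewrite actZ.
apply: sum_act => g; have [|y ->] := key lam (rho g *m B); last first.
  by exists (delta F g^-1%g * y); rewrite actM act_delta.
move=> H hH; have := hB H hH; have /HR_rho/(_ g) := hH; rewrite /compo => e e'.
by rewrite mulmxA e -!mulmxA e'.
Qed.

Lemma sum_Bidx (V : nmodType) (f : Bidx n m -> V) :
  \sum_d f d = \sum_lam \sum_s \sum_J f (lam, (s, J)).
Proof.
under [RHS]eq_bigr => lam _ do rewrite pair_bigA /=.
by rewrite pair_bigA /=; apply: eq_bigr => -[lam [s J]].
Qed.

Definition eval_mx : 'M[F]_(#|{: Bidx n m}|, N) :=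
  mxT (fun (d : Bidx n m) I => rho d.2.1 (enum_rank d.2.2) (enum_rank I)).

(* The inverse of the evaluation on [Dsp]; the factor k^-2 is read off from
   c (c g) s^-1 c = k^2 c(s g^-1) c. *)
Definition coeval_mx : 'M[F]_(N, #|{: Bidx n m}|) :=
  mxT (fun J (d : Bidx n m) => (k d.1 ^+ 2)^-1 *
    (rho d.2.1^-1%g *m C d.1) (enum_rank J) (enum_rank d.2.2)).

Lemma rhoSE lam g s : rhoS F lam (enum_rank g) (enum_rank s) = (ysym F lam * delta F g) s.
Proof. by rewrite mxTE mul_deltaE ffunE. Qed.

Lemma summandE lam r1 r2 (d : Bidx n m) :
  summand R lam (enum_rank (r1, r2)) (enum_rank d) =
  (d.1 == lam)%:R * (rhoS F lam r1 (enum_rank d.2.1) * C lam r2 (enum_rank d.2.2)).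
Proof.
rewrite mulmxTE (bigD1 d.2) //= big1 ?addr0 => [|c cd]; rewrite !mxTE /rhoH cR_act.
  rewrite mulrC; congr (_%:R * _); congr nat_of_bool.
  by case: d => l c /=; rewrite xpair_eqE eqxx andbT.
case: eqP => [e|]; last by rewrite mulr0.
by rewrite e eqxx in cd.
Qed.

Lemma summand_evalE lam g J I :
  (summand R lam *m eval_mx) (enum_rank (enum_rank g, enum_rank J)) (enum_rank I) =
  (C lam *m C lam *m rho g) (enum_rank J) (enum_rank I).
Proof.
rewrite mulmxTE sum_Bidx (bigD1 lam) //= [X in _ + X]big1 ?addr0 => [|mu /negPf ne]; last first.
  by rewrite big1 // => s _; rewrite big1 // => L _; rewrite summandE ne !mul0r.
rewrite -mulmxA -[in RHS]act_delta -actM [in X in _ *m X]/act mulmx_sumr summxE.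
apply: eq_bigr => s _; rewrite -scalemxAr mxE mulmxTE mulr_sumr; apply: eq_bigr => L _.
by rewrite summandE /= eqxx mul1r rhoSE mxTE mulrA.
Qed.

Lemma row_summand_eval lam g j :
  row (enum_rank (enum_rank g, j)) (summand R lam *m eval_mx) = row j (C lam *m C lam *m rho g).
Proof.
apply/rowP=> i; rewrite [LHS]mxE [RHS]mxE -(enum_valK i) -(enum_valK j).
exact: summand_evalE.
Qed.

(** Together with [summand_eval_sub] this identifies the evaluated summand with the span of all
    translates of the image of [C lam], the isotypic block. *)
Lemma C_rho_sub lam g : (C lam *m rho g <= summand R lam *m eval_mx)%MS.
Proof.
rewrite -[C lam](scalerK (kap_neq0 charF lam)) -C_sqr -scalemxAl scalemx_sub //.
by apply/row_subP=> j; rewrite -row_summand_eval row_sub.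
Qed.

Lemma summand_eval_sub lam r (U : 'M[F]_(r, N)) :
  (forall g, (C lam *m rho g <= U)%MS) -> (summand R lam *m eval_mx <= U)%MS.
Proof.
move=> h; apply/row_subP=> i; rewrite -(enum_valK i).
case: (enum_val i) => r1 r2; rewrite -(enum_valK r1) row_summand_eval.
by apply: submx_trans (row_sub _ _) _; rewrite C_sqr -scalemxAl scalemx_sub.
Qed.

Lemma summand_eval_orth lam mu g : lam != mu -> summand R lam *m eval_mx *m rho g *m C mu = 0.
Proof.
move=> ne; apply/eqP; rewrite -mulmxA; apply/eqP/sub_kermxP; apply: summand_eval_sub => h.
by apply/sub_kermxP; rewrite !mulmxA -(mulmxA (C lam)) -rhoM C_orth.
Qed.

Lemma summand_eval_coeval lam : summand R lam *m eval_mx *m coeval_mx = summand R lam.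
Proof.
apply: mxTP => -[r1 r2] d; rewrite -(enum_valK r1) -(enum_valK r2).
move: (enum_val r1) (enum_val r2) => g J.
rewrite mulmxTE summandE.
under eq_bigr => I _ do rewrite summand_evalE mxTE mulrCA.
rewrite -mulr_sumr -mulmxTE; case: d => mu [s I] /=.
rewrite -!mulmxA (mulmxA (rho g)) -rhoM (mulmxA (C lam) (rho _)).
have [->|ne] := eqVneq mu lam; last by rewrite C_orth 1?eq_sym // mulmx0 mxE mulr0 mul0r.
rewrite C_sandwich invMg invgK -scalemxAr C_sqr scalerA mxE mul1r rhoSE mul_deltaE mulrA.
congr (_ * _); have k0 := kap_neq0 charF lam; rewrite mulrAC -expr2 mulrA mulVf ?mul1r //.
by rewrite expf_neq0.
Qed.

Lemma actS_eval s : actS F n s *m eval_mx = eval_mx *m rho s.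
Proof.
apply: mxTP => -[lam [g J]] I; rewrite !mulmxTE.
under [RHS]eq_bigr => K _ do rewrite mxTE /=.
rewrite -[RHS]mulmxTE -rhoM (bigD1 (lam, ((g * s)%g, J))) //= big1 ?addr0 => [|d /negPf ne].
  by rewrite !mxTE /= eqxx mul1r.
by rewrite mxTE ne mul0r.
Qed.

Lemma actH_eval B : HR R B -> actH B *m eval_mx = eval_mx *m B.
Proof.
move=> /HR_rho hB; apply: mxTP => -[lam [g J]] I; rewrite !mulmxTE sum_Bidx.
under [RHS]eq_bigr => K _ do rewrite mxTE /=.
rewrite -[RHS]mulmxTE -hB [RHS]mulmxTE (bigD1 lam) //= [X in _ + X]big1 ?addr0 =>
  [|mu /negPf ne]; last first.
  by rewrite big1 // => s _; rewrite big1 // => K _; rewrite mxTE /= eq_sym ne !mul0r.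
rewrite (bigD1 g) //= [X in _ + X]big1 ?addr0 => [|s /negPf ne]; last first.
  by rewrite big1 // => K _; rewrite mxTE /= eqxx eq_sym ne !mul0r.
by apply: eq_bigr => K _; rewrite !mxTE /= !eqxx mul1r.
Qed.

Lemma summand_sub_Dsp lam : (summand R lam <= Dsp m R)%MS.
Proof. by apply: (sumsmx_sup lam) => //; rewrite genmxE. Qed.

Lemma Dsp_eval_coeval : Dsp m R *m eval_mx *m coeval_mx = Dsp m R.
Proof.
(* [Dsp] is known only through its row space, so the identity is restated as inclusion in a kernel,
   which can be checked on each summand. *)
apply/eqP; rewrite -subr_eq0 -[X in _ - X]mulmx1 -mulmxA -mulmxBr; apply/eqP/sub_kermxP.
apply/sumsmx_subP => lam _; rewrite genmxE; apply/sub_kermxP.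
by rewrite mulmxBr mulmx1 mulmxA summand_eval_coeval subrr.
Qed.

Lemma one_resolution (a : ypart m -> F) : \sum_lam a lam *: central_ysym F lam = 1 ->
  1%:M = \sum_lam a lam *: \sum_g rho g^-1%g *m C lam *m rho g.
Proof.
move=> ha; rewrite -act1 -ha act_sum; apply: eq_bigr => lam _.
rewrite actZ act_sum; congr (_ *: _); apply: eq_bigr => g _.
by rewrite !actM !act_delta.
Qed.

(** Each term g^-1 c g of the resolution of 1 has its image inside that of c g. *)
Lemma Dsp_eval_full : row_full (Dsp m R *m eval_mx).
Proof.
have [a /one_resolution ha] := central_ysym_complete m charF.
rewrite -sub1mx ha; apply: summx_sub => lam _; apply/scalemx_sub/summx_sub => g _.
rewrite -mulmxA; apply: submx_trans (submxMl _ _) _.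
apply: submx_trans (C_rho_sub lam g) _; apply: submxMr; exact: summand_sub_Dsp.
Qed.

Lemma SR_rho g : SR R (rho g).
Proof. by apply/SR_act; exists (delta F g); rewrite act_delta. Qed.

Lemma SR_C lam : SR R (C lam).
Proof. by apply/SR_act; exists (ysym F lam). Qed.

(** The resolution of 1 and orthogonality give some g with U g c_lam nonzero. By stability under
    SR_m this lies in U, so stability under HR_m brings in the whole image of [C lam], and SR_m then
    brings in its translates. *)
Lemma summand_eval_irreducible lam : (0 < \rank (summand R lam *m eval_mx))%N ->
  irreducible_for (fun B : op F n m => SR R B \/ HR R B) (summand R lam *m eval_mx).
Proof.
move=> r0; split=> // U UW stab.
have [->|U0] := eqVneq U 0; first by rewrite mxrank0; left.
right; rewrite UW /=.
have stabHR B : HR R B -> (U *m B <= U)%MS by move=> hB; apply: stab; right.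
have stabSR B : SR R B -> (U *m B <= U)%MS by move=> hB; apply: stab; left.
have [g ug] : exists g, U *m rho g *m C lam != 0.
  apply/existsP; apply: contraNT U0; rewrite negb_exists => /forallP h.
  have [a /one_resolution ha] := central_ysym_complete m charF.
  apply/eqP; rewrite -[LHS]mulmx1 ha mulmx_sumr big1 // => mu _.
  rewrite -scalemxAr mulmx_sumr big1 ?scaler0 // => g _; rewrite !mulmxA.
  suff -> : U *m rho g^-1%g *m C mu = 0 by rewrite mul0mx.
  have [->|ne] := eqVneq mu lam; first by have := h g^-1%g; rewrite negbK => /eqP.
  have /submxP[E ->] := UW; rewrite -2!(mulmxA E) summand_eval_orth ?mulmx0 //.
  by rewrite eq_sym.
have /rowV0Pn[u uU u0] := ug.
have uUU : (u <= U)%MS.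
  apply: submx_trans uU _; apply: submx_trans (submxMr _ (stabSR _ (SR_rho g))) _.
  exact: stabSR (SR_C lam).
have uk : u *m C lam = k lam *: u.
  by have /submxP[E ->] := uU; rewrite -!mulmxA C_sqr -!scalemxAr.
have CU := C_sub_HR_stable stabHR uUU u0 uk.
apply: summand_eval_sub => h.
exact: submx_trans (submxMr _ CU) (stabSR _ (SR_rho h)).
Qed.

(** [C lam] annihilates the block of mu, so an intertwiner T kills W c_lam. But T is injective on W,
    so c_lam kills W, which contains its own image; then k c_lam = c_lam c_lam = 0 and the block
    vanishes. *)
Lemma summand_eval_not_iso lam mu : lam != mu -> (0 < \rank (summand R lam *m eval_mx))%N ->
  ~ exists T : op F n m,
    [/\ \rank (summand R lam *m eval_mx *m T) = \rank (summand R lam *m eval_mx),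
        (summand R lam *m eval_mx *m T == summand R mu *m eval_mx)%MS &
        forall (x : 'rV[F]_N) (B : op F n m),
          (x <= summand R lam *m eval_mx)%MS -> SR R B \/ HR R B -> x *m B *m T = x *m T *m B].
Proof.
move=> ne r0 [T [rT /andP[WT _] comm]]; set W := summand R lam *m eval_mx in r0 rT WT comm *.
have WC : (W *m C lam <= W)%MS.
  apply: submx_trans (submxMl _ _) _.
  by rewrite -[C lam]mulmx1 -rho1 C_rho_sub.
have WCT : W *m C lam *m T = 0.
  apply/row_matrixP=> i; rewrite row0 row_mul (row_mul i W) comm ?row_sub //; last by left;
    exact: SR_C.
  have /submxP[E e] : (row i W *m T <= summand R mu *m eval_mx)%MS.
    by apply: submx_trans WT; apply: submxMr; exact: row_sub.
  rewrite e -mulmxA -[summand R mu *m eval_mx]mulmx1 -rho1 summand_eval_orth ?mulmx0 //.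
  by rewrite eq_sym.
(* Rank-nullity: T preserves the rank of W. *)
have ker0 : (W :&: kermx T)%MS = 0.
  apply/eqP; rewrite -mxrank_eq0 -(eqn_add2l (\rank (W *m T))) mxrank_mul_ker rT.
  by rewrite addn0.
have WC0 : W *m C lam = 0.
  by apply/eqP; rewrite -submx0 -ker0 sub_capmx WC; apply/sub_kermxP.
have C0 : C lam = 0.
  apply: (scalerI (kap_neq0 charF lam)); rewrite scaler0 -C_sqr.
  have CW : (C lam <= W)%MS by rewrite -[C lam]mulmx1 -rho1 C_rho_sub.
  have := submxMr (C lam) CW; rewrite WC0 => h.
  by apply/eqP; rewrite -submx0; apply: submx_trans h (sub0mx _ _).
have : (W <= (0 : 'M[F]_N))%MS.
  by apply: summand_eval_sub => g; rewrite C0 mul0mx.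
by rewrite submx0 -mxrank_eq0 => /eqP w0; rewrite w0 in r0.
Qed.

Lemma eval_mx_decomposition : SW_decomposition R eval_mx.
Proof.
split=> /=.
- split; last exact: Dsp_eval_full.
  apply/eqP; rewrite eqn_leq mxrankM_maxl /= -{1}Dsp_eval_coeval.
  exact: mxrankM_maxl.
- by move=> s x _; rewrite -!mulmxA actS_eval.
- by move=> h x hh _; rewrite -!mulmxA actH_eval.
- exact: summand_eval_irreducible.
by move=> lam mu ne r0 _; exact: summand_eval_not_iso.
Qed.
End SchurWeyl.

Theorem theoremA5 (F : fieldType) (n m : nat) (R : 'I_n -> 'I_n -> 'I_n -> 'I_n -> F) :
  [pchar F] =i pred0 ->
  R_unitary R -> qybe R ->
  [/\ forall A : op F n m, (forall S, SR R S -> compo A S = compo S A) <-> HR R A,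
      forall A : op F n m, (forall H, HR R H -> compo A H = compo H A) <-> SR R A,
      forall (lam : ypart m) (h : op F n m), HR R h -> stable_under h (rhoH R lam),
      forall lam : ypart m, (0 < \rank (rhoH R lam))%N -> irreducible_for (@HR F n R m) (rhoH R lam) &
      exists Phi, @SW_decomposition F n m R Phi].
Proof.
move=> charF U Y; split.
- move=> A; split=> [hA|hA S /(SR_act U Y)[x ->]]; last by rewrite /compo (HR_act U Y).
  apply: commutes_HR => b; rewrite -[LHS]/(compo (gen_op R b) A) -[RHS]/(compo A (gen_op R b)).
  symmetry; apply: hA; exists [:: [:: b]], [:: 1].
  by rewrite big_ord1 scale1r /= word_op1.
- move=> A; split=> [|/(SR_act U Y)[x ->] H hH]; first exact: SR_bicommutant.
  by rewrite /compo (HR_act U Y).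
- move=> lam h hh; rewrite /stable_under /rhoH (cR_act R lam) -(HR_act U Y _ hh).
  exact: submxMl.
- by move=> lam; rewrite /rhoH cR_act; exact: C_irreducible.
by exists (eval_mx m R); exact: eval_mx_decomposition.
Qed.
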